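(* Every topological parallelism $\Pi$ of $\mathrm{PG}(3,\mathbb{R})$ gives rise to a unique oriented topological parallelism $\Pi^+$, which consists of all oriented spreads covering members of $\Pi$; that is, the set $\Pi^+$ of all oriented spreads covering members of $\Pi$ is an oriented topological parallelism.
   Context: $\mathcal{L}$ is the space of lines of $\mathrm{PG}(3,\mathbb{R})$ (2-dimensional subspaces of $\mathbb{R}^4$) and $\mathcal{L}^+$ the space of oriented lines (2-dimensional subspaces with a vector space orientation), both topologized as coset spaces of $\mathrm{PGL}(4,\mathbb{R})$; forgetting orientation gives a twofold covering $\mathcal{L}^+\to\mathcal{L}$. A compact spread is a compact set of pairwise disjoint lines covering the point set of $\mathrm{PG}(3,\mathbb{R})$. A compact spread $\mathcal{C}$ is homeomorphic to the 2-sphere, its inverse image in $\mathcal{L}^+$ is a disjoint union of two 2-spheres, each mapped homeomorphically onto $\mathcal{C}$; each of these is called an oriented spread (covering $\mathcal{C}$). A topological parallelism is a set of pairwise disjoint compact spreads covering $\mathcal{L}$ that is a compact subset of the hyperspace of all compact subsets of $\mathcal{L}$ (endowed with the Hausdorff topology). An oriented topological parallelism is a set of pairwise disjoint compact oriented spreads covering $\mathcal{L}^+$ that is a compact subset of the hyperspace of all compact subsets of $\mathcal{L}^+$. *)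

(* Defs.v *)
From HB Require Import structures.
From mathcomp Require Import all_boot all_order all_algebra.
From mathcomp Require Import all_classical all_reals all_analysis.

Set Implicit Arguments.
Unset Strict Implicit.
Unset Printing Implicit Defensive.

Import Order.TTheory GRing.Theory Num.Theory.
Import numFieldNormedType.Exports.

Local Open Scope classical_set_scope.
Local Open Scope ring_scope.
Local Open Scope quotient_scope.

Section ProjectiveGroup.
Variable R : realType.

(* GL carries the subspace topology of 'M[R]_4. *)
Definition GL : Type := set_type [set g : 'M[R]_4 | g \in unitmx].

Definition gl_mx (g : GL) : 'M[R]_4 := \val g.

Lemma gl_unit (g : GL) : gl_mx g \in unitmx.
Proof. by have := valP g; rewrite inE. Qed.

Definition scalar_multiple (g h : GL) : bool :=
  `[< exists2 c : R, c != 0 & gl_mx g = c *: gl_mx h >].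

Lemma scalar_multiple_refl : reflexive scalar_multiple.
Proof. by move=> g; apply/asboolP; exists 1; rewrite ?oner_eq0 ?scale1r. Qed.

Lemma scalar_multiple_sym : symmetric scalar_multiple.
Proof.
suff H g h : scalar_multiple g h -> scalar_multiple h g.
  by move=> g h; apply/idP/idP; exact: H.
move=> /asboolP[c c0 gh]; apply/asboolP; exists c^-1; first by rewrite invr_eq0.
by rewrite gh scalerA mulVf ?scale1r.
Qed.

Lemma scalar_multiple_trans : transitive scalar_multiple.
Proof.
move=> h g k /asboolP[c c0 gh] /asboolP[e e0 hk]; apply/asboolP.
by exists (c * e); rewrite ?mulf_neq0// gh hk scalerA.
Qed.

Canonical scalar_multiple_equiv := EquivRel scalar_multiple
  scalar_multiple_refl scalar_multiple_sym scalar_multiple_trans.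

Definition PGL : Type := quotient_topology {eq_quot scalar_multiple_equiv}.

End ProjectiveGroup.

Section Lines.
Variable R : realType.
Notation V := 'cV[R]_4.
Implicit Types (U : {vspace V}) (g : GL R) (b : 2.-tuple V).

Definition point := {p : {vspace V} | \dim p == 1}.
Definition line := {U : {vspace V} | \dim U == 2}.

Definition points_of (L : line) : set point := [set p | (\val p <= \val L)%VS].

Definition gl_fun g : 'Hom(V, V) := linfun (mulmx (gl_mx g)).

Lemma gl_funE g (v : V) : gl_fun g v = gl_mx g *m v.
Proof. by rewrite lfunE. Qed.

Lemma gl_fun_inj g : injective (gl_fun g).
Proof.
move=> u v; rewrite !gl_funE => /(congr1 (mulmx (invmx (gl_mx g)))).
by rewrite !mulKmx ?gl_unit.
Qed.

Lemma gl_fun_ker g U : (U :&: lker (gl_fun g) = 0)%VS.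
Proof.
suff /eqP-> : lker (gl_fun g) == 0%VS by rewrite capv0.
by apply/lker0P; exact: gl_fun_inj.
Qed.

Lemma gl_line_subproof g (L : line) : \dim (gl_fun g @: \val L)%VS == 2.
Proof. by rewrite limg_dim_eq ?gl_fun_ker// (valP L). Qed.

Definition gl_line g (L : line) : line := exist _ (gl_fun g @: \val L)%VS (gl_line_subproof g L).

(* The orientations of U are the classes of ordered bases of U for the
   relation "the change of basis has positive determinant". *)
Definition basis_change b b' : 'M[R]_2 :=
  \matrix_(i, j) coord b j (tnth b' i).

Definition orientation_class U b : set (2.-tuple V) :=
  [set b' : 2.-tuple V | basis_of U b' /\ 0 < \det (basis_change b b')].

Definition is_orientation U (O : set (2.-tuple V)) : Prop :=
  exists2 b : 2.-tuple V, basis_of U b & O = orientation_class U b.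

Record oline := OLine {
  forget : line;
  orientation : set (2.-tuple V);
  orientationP : is_orientation (\val forget) orientation }.

Lemma oline_eq (l m : oline) :
  forget l = forget m -> orientation l = orientation m -> l = m.
Proof.
case: l m => [L O HO] [M P HP] /= LM OP; rewrite -{}LM -{}OP in HP *.
by congr OLine; exact: Prop_irrelevance.
Qed.

Definition gl_basis g b : 2.-tuple V := map_tuple (gl_fun g) b.

Lemma gl_basis_of g U b :
  basis_of U b -> basis_of (gl_fun g @: U)%VS (gl_basis g b).
Proof. exact/limg_basis_of/gl_fun_ker. Qed.

Lemma gl_basis_change g U b b' : basis_of U b -> basis_of U b' ->
  basis_change (gl_basis g b) (gl_basis g b') = basis_change b b'.
Proof.
move=> bU b'U; apply/matrixP => i j; rewrite !mxE tnth_map.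
have vb : tnth b' i \in <<b>>%VS.
  by rewrite (span_basis bU); apply: (basis_mem b'U); exact: mem_tnth.
rewrite [in LHS](coord_span vb) linear_sum/=.
under eq_bigr => k _ do
  rewrite linearZ/= -(nth_map _ 0) ?size_tuple//.
by rewrite coord_sum_free// (basis_free (gl_basis_of g bU)).
Qed.

Lemma gl_orientation_subproof g U (O : set (2.-tuple V)) :
  is_orientation U O ->
  is_orientation (gl_fun g @: U)%VS [set gl_basis g b | b in O].
Proof.
move=> [b bU ->]; exists (gl_basis g b); first exact: gl_basis_of.
apply/seteqP; split=> [_ [b' [b'U b'0] <-]|c [cU c0]].
  by split; [exact: gl_basis_of|rewrite (gl_basis_change g bU b'U)].
pose b' : 2.-tuple V := map_tuple (mulmx (invmx (gl_mx g))) c.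
have gb' : gl_basis g b' = c.
  apply: eq_from_tnth => i; rewrite !tnth_map gl_funE.
  by rewrite mulKVmx ?gl_unit.
have b'U : basis_of U b'.
  rewrite basisEdim; apply/andP; split; last first.
    have := cU; rewrite basisEdim size_tuple => /andP[_].
    by rewrite limg_dim_eq ?gl_fun_ker// size_tuple.
  apply/subvP => u uU.
  have : gl_fun g u \in <<c>>%VS by rewrite (span_basis cU) memv_img.
  rewrite -gb' -limg_span => /memv_imgP[w wb' /gl_fun_inj->].
  exact: wb'.
exists b' => //; split=> //.
by rewrite -(gl_basis_change g bU b'U) gb'.
Qed.

Definition gl_oline g (l : oline) : oline :=
  OLine (forget := gl_line g (forget l))
    (gl_orientation_subproof g (orientationP l)).

Definition pgl_line (q : PGL R) : line -> line := gl_line (repr q).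
Definition pgl_oline (q : PGL R) : oline -> oline := gl_oline (repr q).

Lemma gl_img_scale g h (c : R) U : c != 0 -> gl_mx g = c *: gl_mx h ->
  (gl_fun g @: U <= gl_fun h @: U)%VS.
Proof.
move=> c0 gh; apply/subvP => _ /memv_imgP[u uU ->].
rewrite gl_funE gh -scalemxAl -gl_funE; exact/memvZ/memv_img.
Qed.

Lemma gl_line_scale g h L : scalar_multiple g h -> gl_line g L = gl_line h L.
Proof.
move=> gh; apply: val_inj; apply/eqP; rewrite /= eqEsubv.
have := gh; rewrite scalar_multiple_sym => /asboolP[e e0 hg].
by move/asboolP: gh => [c c0 gh]; rewrite (gl_img_scale _ c0 gh)
  (gl_img_scale _ e0 hg).
Qed.

Lemma gl_oline_scale g h l : scalar_multiple g h -> gl_oline g l = gl_oline h l.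
Proof.
move=> gh; apply: oline_eq; first exact: gl_line_scale.
have := gh; rewrite scalar_multiple_sym => hg.
suff H g' h' : scalar_multiple g' h' ->
    [set gl_basis g' b | b in orientation l] `<=`
    [set gl_basis h' b | b in orientation l].
  by apply/seteqP; split; exact: H.
move=> {gh hg} /asboolP[c c0 gh] _ [b Ob <-].
case: (orientationP l) => a aU Oa; rewrite Oa in Ob *.
case: Ob => bU ab0.
have cb (i : 'I_2) :
    tnth (map_tuple ( *:%R c) b : 2.-tuple V) i = c *: tnth b i.
  by rewrite tnth_map.
have cbU : basis_of (\val (forget l)) (map_tuple ( *:%R c) b).
  rewrite basisEdim size_tuple (eqP (valP (forget l))) andbT.
  apply/subvP => u; rewrite -(span_basis bU) => /coord_span ->.
  apply: memv_suml => i _; apply: memvZ.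
  rewrite -(tnth_nth _ b) -[tnth b i](scalerK c0) memvZ// -cb.
  by rewrite memv_span// mem_tnth.
exists (map_tuple ( *:%R c) b); first split=> //.
  have -> : basis_change a (map_tuple ( *:%R c) b) = c *: basis_change a b.
    by apply/matrixP => i j; rewrite !mxE cb linearZ.
  by rewrite detZ mulr_gt0// exprn_even_gt0.
apply: eq_from_tnth => i; rewrite tnth_map cb tnth_map.
by rewrite !gl_funE gh -scalemxAl -scalemxAr.
Qed.

Lemma repr_pi_scale g : scalar_multiple (repr (\pi_(PGL R) g)) g.
Proof. by apply/eqmodP; rewrite reprK. Qed.

(* The actions of PGL do not depend on the representatives chosen by repr. *)
Lemma pgl_lineE g L : pgl_line (\pi_(PGL R) g) L = gl_line g L.
Proof. exact/gl_line_scale/repr_pi_scale. Qed.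

Lemma pgl_olineE g l : pgl_oline (\pi_(PGL R) g) l = gl_oline g l.
Proof. exact/gl_oline_scale/repr_pi_scale. Qed.

Definition base_basis : 2.-tuple V :=
  [tuple delta_mx (inord 0) 0; delta_mx (inord 1) 0].

Lemma base_basis_free : free base_basis.
Proof.
have e01 : (inord 1 == inord 0 :> 'I_4) = false.
  by apply/eqP => /(congr1 val); rewrite /= !inordK.
apply/freeP => k; rewrite !big_ord_recl big_ord0 addr0 => k0.
have k1 i := congr1 (fun v : V => v i 0) k0.
have := k1 (inord 0); have := k1 (inord 1).
rewrite !mxE !eqxx e01 eq_sym e01 !mulr0 !mulr1 addr0 add0r => kb ka.
move=> i; case: (unliftP ord0 i) => [j|] -> //; rewrite ord1.
by rewrite -[RHS]kb; congr k; exact: val_inj.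
Qed.

Lemma base_line_subproof : \dim <<base_basis>>%VS == 2.
Proof. exact: base_basis_free. Qed.

Definition base_line : line := exist _ <<base_basis>>%VS base_line_subproof.

Lemma base_oline_subproof : is_orientation (\val base_line)
  (orientation_class (\val base_line) base_basis).
Proof.
by exists base_basis => //; rewrite /basis_of eqxx base_basis_free.
Qed.

Definition base_oline : oline := OLine base_oline_subproof.

(* line and oline are homogeneous under PGL; as coset spaces of PGL they carry
   the quotient topology of the orbit maps at base_line and base_oline. *)
Definition line_open (A : set line) : Prop :=
  open [set q : PGL R | A (pgl_line q base_line)].

Definition oline_open (A : set oline) : Prop :=
  open [set q : PGL R | A (pgl_oline q base_oline)].

Lemma line_openT : line_open setT. Proof. exact: openT. Qed.

Lemma line_openI : setI_closed line_open.
Proof. by move=> A B; exact: openI. Qed.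

Lemma line_open_bigU (I : Type) (f : I -> set line) :
  (forall i, line_open (f i)) -> line_open (\bigcup_i f i).
Proof. by move=> fo; apply: bigcup_open => i _; exact: fo. Qed.

Lemma oline_openT : oline_open setT. Proof. exact: openT. Qed.

Lemma oline_openI : setI_closed oline_open.
Proof. by move=> A B; exact: openI. Qed.

Lemma oline_open_bigU (I : Type) (f : I -> set oline) :
  (forall i, oline_open (f i)) -> oline_open (\bigcup_i f i).
Proof. by move=> fo; apply: bigcup_open => i _; exact: fo. Qed.

HB.instance Definition _ := Choice.on line.
HB.instance Definition _ :=
  isOpenTopological.Build line line_openT line_openI line_open_bigU.

HB.instance Definition _ := gen_eqMixin oline.
HB.instance Definition _ := gen_choiceMixin oline.
HB.instance Definition _ :=
  isOpenTopological.Build oline oline_openT oline_openI oline_open_bigU.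

End Lines.

Section Hyperspace.
Variables (R : realType) (T : topologicalType).

Definition metrizes (d : T -> T -> R) : Prop :=
  [/\ forall x y, d x y = 0 <-> x = y,
      forall x y, d x y = d y x,
      forall x y z, d x z <= d x y + d y z &
      forall x (A : set T),
        nbhs x A <-> exists2 e, 0 < e & [set y | d x y < e] `<=` A].

(* The space of all compact subsets of T, topologized through d below. *)
Record hyperspace (d : T -> T -> R) := Hyperspace {
  hset : set T;
  hset_compact : compact hset }.

Variable d : T -> T -> R.

(* For nonempty compact K and K' and a metric d, this says that the Hausdorff
   distance of K and K' is less than e; the empty set is isolated. *)
Definition hausdorff_ball (K : set T) (e : R) (K' : set T) : Prop :=
  (forall x, K x -> exists2 y, K' y & d x y < e) /\
  (forall y, K' y -> exists2 x, K x & d x y < e).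

Definition hausdorff_open (W : set (hyperspace d)) : Prop :=
  forall K, W K -> exists2 e, 0 < e &
    [set K' | hausdorff_ball (hset K) e (hset K')] `<=` W.

Lemma hausdorff_openT : hausdorff_open setT.
Proof. by move=> K _; exists 1. Qed.

Lemma hausdorff_ballS K K' e e' : e <= e' ->
  hausdorff_ball K e K' -> hausdorff_ball K e' K'.
Proof.
move=> ee' [K1 K2]; split=> x Kx.
  by have [y ? dxy] := K1 _ Kx; exists y => //; exact: lt_le_trans ee'.
by have [y ? dxy] := K2 _ Kx; exists y => //; exact: lt_le_trans ee'.
Qed.

Lemma hausdorff_openI : setI_closed hausdorff_open.
Proof.
move=> A B Ao Bo K [/Ao[e e0 eA] /Bo[f f0 fB]].
exists (Num.min e f); first by rewrite lt_min e0.
move=> K' KK'; split.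
  by apply: eA; apply: hausdorff_ballS KK'; rewrite ge_min lexx.
by apply: fB; apply: hausdorff_ballS KK'; rewrite ge_min lexx orbT.
Qed.

Lemma hausdorff_open_bigU (I : Type) (f : I -> set (hyperspace d)) :
  (forall i, hausdorff_open (f i)) -> hausdorff_open (\bigcup_i f i).
Proof.
move=> fo K [i _ /fo[e e0 ef]]; exists e => // K' KK'.
by exists i => //; exact: ef.
Qed.

HB.instance Definition _ := gen_eqMixin (hyperspace d).
HB.instance Definition _ := gen_choiceMixin (hyperspace d).
HB.instance Definition _ := isOpenTopological.Build (hyperspace d)
  hausdorff_openT hausdorff_openI hausdorff_open_bigU.

End Hyperspace.

(* The Hausdorff topology on the compact subsets of a metrizable space depends
   only on the topology, not on the choice of the metric d. *)
Definition hyperspace_compact (R : realType) (T : topologicalType)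
    (P : set (set T)) : Prop :=
  P `<=` compact /\
  exists2 d : T -> T -> R, metrizes d &
    compact [set K : hyperspace d | P (hset K)].

Definition homeomorphism_on (X Y : topologicalType) (A : set X) (B : set Y)
    (f : X -> Y) : Prop :=
  [/\ set_bij A B f, {within A, continuous f} &
      exists2 g : Y -> X, {in A, cancel f g} & {within B, continuous g}].

Section Parallelisms.
Variable R : realType.
Implicit Types (C : set (line R)) (S : set (oline R)).

Definition unit_sphere2 : set 'rV[R]_3 := [set x | \sum_i x 0 i ^+ 2 = 1].

Definition two_sphere (X : topologicalType) (A : set X) : Prop :=
  exists f : X -> 'rV[R]_3, homeomorphism_on A unit_sphere2 f.

Definition compact_spread C : Prop :=
  [/\ compact C, trivIset C (@points_of R) &
      \bigcup_(L in C) points_of L = setT].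

Definition oriented_spread_covering C S : Prop :=
  exists S', [/\ @forget R @^-1` C = S `|` S', S `&` S' = set0,
    two_sphere S /\ two_sphere S',
    homeomorphism_on S C (@forget R) & homeomorphism_on S' C (@forget R)].

Definition oriented_spread S : Prop :=
  exists2 C, compact_spread C & oriented_spread_covering C S.

Definition topological_parallelism (P : set (set (line R))) : Prop :=
  [/\ P `<=` compact_spread, trivIset P id, \bigcup_(C in P) C = setT &
      hyperspace_compact R P].

Definition oriented_topological_parallelism (Q : set (set (oline R))) : Prop :=
  [/\ Q `<=` oriented_spread, trivIset Q id, \bigcup_(S in Q) S = setT &
      hyperspace_compact R Q].

End Parallelisms.

(* Main.v *)
(** The Pluecker matrix [u v^T - v u^T], normalized to norm 1, embeds the space of
oriented lines into the 4x4 matrices, and reversing the orientation changes its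
sign.  Let [C] be a compact spread and [W], [X] two of its lines.  Intersecting
the lines of [C] with a plane through [W] maps [C \ {W}] bijectively onto an
affine plane, and sending [W] to infinity gives a homeomorphism from [C] onto the
2-sphere.  Two of the Pluecker coordinates vanish on [C] only at [X] and only at
[W], respectively.  Their product does not change sign on the connected set
[C \ {W, X}], so their sum or their difference [w] vanishes nowhere on [C].  The
sign of [w] separates the preimage of [C] into two sheets, and by connectedness
these are the only oriented spreads covering [C].

The same [w] is nonvanishing on all members of the parallelism near [C], so the
sheets over them converge to those over [C] in the Hausdorff topology.  Given an
ultrafilter of oriented spreads, the spreads they cover converge to some [C] by
compactness of the parallelism; the ultrafilter chooses one sign of [w] and
converges to the corresponding sheet over [C]. *)

From HB Require Import structures.
Require Import Defs.
From mathcomp Require Import all_boot all_order all_algebra.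
From mathcomp Require Import all_classical all_reals all_analysis.
From mathcomp Require Import ring lra.

Set Implicit Arguments.
Unset Strict Implicit.
Unset Printing Implicit Defensive.

Import Order.TTheory GRing.Theory Num.Theory.
Import numFieldNormedType.Exports.

Local Open Scope classical_set_scope.
Local Open Scope ring_scope.

(** * Pluecker matrices of oriented lines *)

Section Wedge.
Variable R : realType.
Notation V := 'cV[R]_4.
Implicit Types (u v x y : V) (b : 2.-tuple V) (U : {vspace V}) (g : GL R).

Definition wedge u v : 'M[R]_4 := u *m v^T - v *m u^T.

Lemma wedgeE u v i j : wedge u v i j = u i 0 * v j 0 - v i 0 * u j 0.
Proof. by rewrite !mxE !big_ord1 !mxE. Qed.

Lemma mul_wedge (k : 'M[R]_4) u v :
  k *m wedge u v *m k^T = wedge (k *m u) (k *m v).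
Proof. by rewrite /wedge mulmxBr mulmxBl !trmx_mul !mulmxA. Qed.

Lemma wedge_lin u v (a b c d : R) :
  wedge (a *: u + b *: v) (c *: u + d *: v) = (a * d - c * b) *: wedge u v.
Proof. by apply/matrixP => i j; rewrite [RHS]mxE !wedgeE !mxE; ring. Qed.

Lemma wedgeZ u v (a b : R) : wedge (a *: u) (b *: v) = (a * b) *: wedge u v.
Proof. by apply/matrixP => i j; rewrite [RHS]mxE !wedgeE !mxE; ring. Qed.

Lemma wedge_apply u v x :
  wedge u v *m x = (v^T *m x) 0 0 *: u - (u^T *m x) 0 0 *: v.
Proof.
rewrite /wedge mulmxBl -!mulmxA [v^T *m x]mx11_scalar [u^T *m x]mx11_scalar.
by rewrite !mul_mx_scalar !mxE !mulr1n.
Qed.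

(** [M *m x] and [M *m y] lie in the span of [u] and [v], and the determinant of their coefficients
    is the value of the alternating form [M] at [x] and [y]. Hence two independent vectors in the
    image recover [M] up to a factor. *)
Lemma wedge_image u v x y : let M := wedge u v in
  wedge (M *m x) (M *m y) = (x^T *m M *m y) 0 0 *: M.
Proof.
move=> M; rewrite /M !wedge_apply -!scaleNr wedge_lin; congr (_ *: _).
rewrite -mulmxA wedge_apply mulmxBr -!scalemxAr !mxE.
have tr (w z : V) : \sum_j w^T 0 j * z j 0 = \sum_j z^T 0 j * w j 0.
  by apply: eq_bigr => j _; rewrite !mxE mulrC.
by rewrite (tr x u) (tr x v); ring.
Qed.

Definition plucker b : 'M[R]_4 := wedge b`_0 b`_1.

Lemma det_mx2 (A : 'M[R]_2) : \det A = A 0 0 * A 1 1 - A 1 0 * A 0 1.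
Proof.
rewrite (expand_det_row _ 0) !big_ord_recl big_ord0 addr0.
rewrite /cofactor !det_mx11 !mxE /=.
have -> : lift 0 0 = 1 :> 'I_2 by exact: val_inj.
have -> : lift 1 0 = 0 :> 'I_2 by exact: val_inj.
by rewrite expr0 mul1r expr1; ring.
Qed.

Lemma plucker_change U b b' : basis_of U b -> basis_of U b' ->
  plucker b' = \det (basis_change b b') *: plucker b.
Proof.
move=> bU b'U.
have E (i : 'I_2) : b'`_i = basis_change b b' i 0 *: b`_0 + basis_change b b' i 1 *: b`_1.
  have ib : tnth b' i \in <<b>>%VS.
    by rewrite (span_basis bU) (basis_mem b'U) ?mem_tnth.
  rewrite -tnth_nth !mxE [LHS](coord_span ib) !big_ord_recl big_ord0 addr0.
  have -> // : lift ord0 ord0 = 1 :> 'I_2 by exact: val_inj.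
have := E 0; have := E 1; rewrite /plucker => /= -> ->.
by rewrite wedge_lin det_mx2.
Qed.

(** As rows, the two vectors form a matrix of full rank, which completes to an invertible one. Thus
    [GL] is transitive on ordered bases of lines. *)
Lemma extend_frame b : free b -> exists g, gl_basis g (base_basis R) = b.
Proof.
move=> bf; pose A : 'M[R]_(2, 4) := \matrix_(i, j) b`_i j 0.
have Af : row_free A.
  apply: inj_row_free => w wA; apply/rowP => i; rewrite mxE.
  move/freeP: bf => /(_ (fun i => w 0 i)); apply.
  apply/colP => j; rewrite summxE.
  transitivity ((w *m A) 0 j); last by rewrite wA !mxE.
  rewrite mxE.
  by apply: eq_bigr => k _; rewrite !mxE.
(* [f] consists of the rows of [A] and two zero rows; [complete_unitmx] replaces it by an invertible
   matrix with the same first two rows. *)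
pose P : 'M[R]_(2, 4) := pid_mx 2; pose f : 'M[R]_4 := (P^T *m A).
have PPT : P *m P^T = 1%:M by rewrite tr_pid_mx mul_pid_mx !minnn pid_mx_1.
have PfA : P *m f = A by rewrite mulmxA PPT mul1mx.
have rP : \rank (P *m f) = \rank P.
  by rewrite PfA (eqP Af) rank_pid_mx.
have [g gu] := complete_unitmx rP; rewrite PfA => Ag.
have gu' : g^T \in [set h : 'M[R]_4 | h \in unitmx].
  by rewrite inE /= unitmx_tr.
exists (SigSub gu' : GL R).
apply: eq_from_tnth => i; rewrite tnth_map gl_funE.
have -> : gl_mx (SigSub gu' : GL R) = g^T by [].
have -> : tnth (base_basis R) i = P^T *m delta_mx i 0.
  apply/colP => j; rewrite tr_pid_mx -colE !mxE.
  case: i => [[|[|//]] ilt]; rewrite !mxE /= eqxx andbT; congr (_%:R).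
    by rewrite -val_eqE /= inordK //; case: eqP => // ->.
  by rewrite -val_eqE /= inordK //; case: eqP => // ->.
rewrite mulmxA -trmx_mul -Ag -colE; apply/colP => j.
by rewrite !mxE (tnth_nth 0).
Qed.

Lemma base_basis_dot (i j : 'I_2) :
  ((base_basis R)`_i)^T *m (base_basis R)`_j = (i == j)%:R%:M.
Proof.
rewrite -!tnth_nth.
have bE (h : 'I_2) : tnth (base_basis R) h = delta_mx (inord h) 0.
  by case: h => [[|[|//]] hlt].
have -> : (i == j) = (inord i == inord j :> 'I_4).
  by rewrite -!val_eqE /= !inordK // (ltn_trans (ltn_ord _)).
rewrite !bE trmx_delta mul_delta_mx_cond; apply/matrixP => p q.
by rewrite !ord1; case: (_ == _); rewrite ?mulr0n ?mulr1n !mxE.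
Qed.

(** If [y0], [y1] are dual to the two vectors of [b], then [wedge_apply] yields the solutions
    [x0 = y1] and [x1 = - y0]. The dual vectors come from a frame extending [b]. *)
Lemma plucker_solve b : free b -> exists x0 x1,
  [/\ plucker b *m x0 = b`_0, plucker b *m x1 = b`_1 &
      (x0^T *m plucker b *m x1) 0 0 = 1].
Proof.
move=> /extend_frame[g gb]; set k := invmx (gl_mx g).
have ek (i j : 'I_2) : (b`_i)^T *m (k^T *m (base_basis R)`_j) = (i == j)%:R%:M.
  rewrite -gb -tnth_nth -tnth_nth tnth_map gl_funE.
  rewrite trmx_mul -mulmxA [_ *m (k^T *m _)]mulmxA -trmx_mul mulVmx ?gl_unit //.
  rewrite trmx1 mul1mx.
  by rewrite !(tnth_nth 0) base_basis_dot.
exists (k^T *m (base_basis R)`_1), (- (k^T *m (base_basis R)`_0)).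
have e0 : plucker b *m (k^T *m (base_basis R)`_1) = b`_0.
  rewrite wedge_apply (ek 1 1) (ek 0 1) !(mxE, mulr1n, mul0rn) scale1r.
  by rewrite scale0r subr0.
have e1 : plucker b *m - (k^T *m (base_basis R)`_0) = b`_1.
  rewrite mulmxN wedge_apply (ek 1 0) (ek 0 0) !(mxE, mulr1n, mul0rn) scale1r.
  by rewrite scale0r sub0r opprK.
split=> //; rewrite -mulmxA e1.
have -> : (k^T *m (base_basis R)`_1)^T *m b`_1 =
    ((b`_1)^T *m (k^T *m (base_basis R)`_1))^T by rewrite [RHS]trmx_mul trmxK.
by rewrite (ek 1 1) !mxE.
Qed.

Lemma plucker_mem b x : plucker b *m x \in <<b>>%VS.
Proof.
have m i : (i < 2)%N -> b`_i \in <<b>>%VS.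
  by move=> i2; rewrite memv_span // mem_nth // size_tuple.
by rewrite wedge_apply memvB // memvZ // m.
Qed.

Lemma plucker_neq0 b : free b -> plucker b != 0.
Proof.
move=> bf; have [x [_ [e _ _]]] := plucker_solve bf.
apply/eqP => p0; rewrite p0 mul0mx in e.
have := free_not0 bf (mem_nth 0 (_ : 0 < size b)%N).
by rewrite size_tuple -e eqxx => /(_ isT).
Qed.

(** The span of a basis is the image of its Pluecker matrix, so a scalar factor does not affect
    it. *)
Lemma plucker_span b b' (c : R) : free b -> free b' ->
  plucker b' = c *: plucker b -> <<b'>>%VS = <<b>>%VS.
Proof.
move=> bf b'f e; apply/eqP; rewrite eqEdim.
have [x0 [x1 [e0 e1 _]]] := plucker_solve b'f.
rewrite (eqP bf) (eqP b'f) !size_tuple leqnn andbT; apply/span_subvP => v.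
move=> /(nthP 0)[i]; rewrite size_tuple; case: i => [|[|//]] _ <-.
  by rewrite -e0 e -scalemxAl memvZ ?plucker_mem.
by rewrite -e1 e -scalemxAl memvZ ?plucker_mem.
Qed.

(** A change of basis multiplies the Pluecker matrix by its determinant, so the orientation is read
    off from the sign of that factor. *)
Lemma orientation_classE U b : basis_of U b -> orientation_class U b =
  [set b' : 2.-tuple V | basis_of U b' /\ exists2 c, 0 < c & plucker b' = c *: plucker b].
Proof.
move=> bU; apply/seteqP; split=> b' [b'U].
  by move=> d0; split=> //; exists (\det (basis_change b b')) => //; exact: plucker_change bU b'U.
move=> [c c0 e]; split=> //.
have := plucker_change bU b'U; rewrite e => /eqP.
rewrite -subr_eq0 -scalerBl scaler_eq0 (negbTE (plucker_neq0 (basis_free bU))).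
by rewrite orbF subr_eq0 => /eqP <-.
Qed.

Lemma basis_line (L : line R) b : basis_of (\val L) b = (<<b>>%VS == \val L).
Proof.
rewrite /basis_of; case: eqP => // e.
by rewrite /free e (eqP (valP L)) size_tuple.
Qed.

Lemma orientation_basis (l : oline R) b :
  orientation l b -> basis_of (\val (forget l)) b.
Proof. by case: (orientationP l) => b0 b0U -> []. Qed.

Lemma orientation_ex (l : oline R) : exists b, orientation l b.
Proof.
case: (orientationP l) => b0 b0U ->; exists b0; rewrite orientation_classE //.
by split=> //; exists 1; rewrite ?scale1r.
Qed.

Lemma orientationE (l : oline R) b : orientation l b ->
  orientation l = [set b' : 2.-tuple V | basis_of (\val (forget l)) b' /\
    exists2 c, 0 < c & plucker b' = c *: plucker b].
Proof.
case: (orientationP l) => b0 b0U ->; rewrite orientation_classE //.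
move=> [bU [c c0 e]]; apply/seteqP; split=> b' [b'U [d d0 e']]; split=> //.
  exists (d / c); first exact: divr_gt0.
  by rewrite e e' scalerA divfK // gt_eqF.
by exists (d * c); rewrite ?mulr_gt0 // e' e scalerA.
Qed.

Definition normalize (M : 'M[R]_4) : 'M[R]_4 := `|M|^-1 *: M.

Lemma normalizeZ c M : 0 < c -> normalize (c *: M) = normalize M.
Proof.
move=> c0; rewrite /normalize normrZ gtr0_norm // scalerA invfM mulrAC mulVf ?mul1r //.
by rewrite gt_eqF.
Qed.

(** The basis picked by [xget] is irrelevant: bases of one orientation differ by a positive factor,
    which [normalize] removes ([plE]). The default is never taken, since an orientation is
    nonempty. *)
Definition pl (l : oline R) : 'M[R]_4 :=
  normalize (plucker (xget (base_basis R) (orientation l))).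

Lemma plE l b : orientation l b -> pl l = normalize (plucker b).
Proof.
move=> lb; rewrite /pl; case: xgetP => [b' _ lb'|/(_ b)//].
move: lb'; rewrite (orientationE lb) => -[_ [c c0 ->]].
by rewrite normalizeZ.
Qed.

Lemma pl_orientation l b c : free b -> 0 < c -> plucker b = c *: pl l ->
  orientation l b.
Proof.
move=> bf c0; have [b' lb'] := orientation_ex l.
have b'U := orientation_basis lb'; have b'f := basis_free b'U.
rewrite (plE lb') scalerA => e; rewrite (orientationE lb'); split.
  by rewrite basis_line (plucker_span b'f bf e) (span_basis b'U).
exists (c * `|plucker b'|^-1) => //.
by rewrite mulr_gt0 // invr_gt0 normr_gt0 plucker_neq0.
Qed.

Lemma pl_plucker l b : orientation l b ->
  exists2 c, 0 < c & plucker b = c *: pl l.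
Proof.
move=> lb; have p0 := plucker_neq0 (basis_free (orientation_basis lb)).
exists `|plucker b|; first by rewrite normr_gt0.
by rewrite (plE lb) scalerA divff ?scale1r ?normr_eq0.
Qed.

Lemma pl_wedge l : exists u v, pl l = wedge u v.
Proof.
have [b lb] := orientation_ex l; exists (`|plucker b|^-1 *: b`_0), (1 *: b`_1).
by rewrite (plE lb) wedgeZ mulr1.
Qed.

Lemma pl_image l x y :
  wedge (pl l *m x) (pl l *m y) = (x^T *m pl l *m y) 0 0 *: pl l.
Proof. by have [u [v ->]] := pl_wedge l; rewrite wedge_image. Qed.

Lemma orientation_inj l m b : orientation l b -> orientation m b -> l = m.
Proof.
move=> lb mb; have e : forget l = forget m.
  by apply: val_inj; rewrite -(span_basis (orientation_basis lb)) (span_basis (orientation_basis mb)).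
by apply: oline_eq => //; rewrite (orientationE lb) (orientationE mb) e.
Qed.

Lemma pl_inj : injective pl.
Proof.
move=> l m lm; have [b lb] := orientation_ex l.
have [c c0 e] := pl_plucker lb.
apply: (orientation_inj lb); apply: pl_orientation c0 _ => //.
  exact: basis_free (orientation_basis lb).
by rewrite -lm.
Qed.

Lemma pl_forget l m (c : R) : pl m = c *: pl l -> forget m = forget l.
Proof.
have [a la] := orientation_ex l; have [b mb] := orientation_ex m.
have aU := orientation_basis la; have bU := orientation_basis mb.
have [d d0 ed] := pl_plucker la; have [e e0 ee] := pl_plucker mb.
move=> ml; apply: val_inj; rewrite -(span_basis aU) -(span_basis bU).
apply: (@plucker_span _ _ (e * c * d^-1)); try exact: basis_free aU; try exact: basis_free bU.
by rewrite ee ed ml !scalerA divfK // gt_eqF.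
Qed.

(** The two Pluecker matrices differ by a nonzero determinant, of which normalization keeps only the
    sign. *)
Lemma forget_pl l m : forget l = forget m -> pl m = pl l \/ pl m = - pl l.
Proof.
have [a la] := orientation_ex l; have [b mb] := orientation_ex m.
have aU := orientation_basis la; have bU := orientation_basis mb.
move=> e; rewrite -e in bU; have := plucker_change aU bU.
set c := \det _ => E.
have c0 : c != 0.
  by apply: contra_neq (plucker_neq0 (basis_free bU)) => c0; rewrite E c0 scale0r.
rewrite (plE la) (plE mb) E; case: (ltrgtP c 0) c0 => // c0 _; last by left; rewrite normalizeZ.
right; rewrite -[c]opprK scaleNr /normalize normrN scalerN; congr (- _).
by rewrite -!/(normalize _) normalizeZ ?oppr_gt0.
Qed.

Definition frame_oline (L : line R) b (bL : basis_of (\val L) b) : oline R :=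
  @OLine R L (orientation_class (\val L) b) (ex_intro2 _ _ b bL erefl).

Lemma frame_olineP L b (bL : basis_of (\val L) b) : orientation (frame_oline bL) b.
Proof.
rewrite /= orientation_classE //; split=> //; exists 1 => //.
by rewrite scale1r.
Qed.

Lemma forget_surj L : exists l : oline R, forget l = L.
Proof.
have Ld := valP L.
have bU : basis_of (\val L) (tcast (eqP Ld) (vbasis (\val L))).
  by rewrite val_tcast vbasisP.
by exists (frame_oline bU).
Qed.

Definition swap_basis b : 2.-tuple V := [tuple b`_1; b`_0].

Lemma swap_basis_span b : <<swap_basis b>>%VS = <<b>>%VS.
Proof. by apply: eq_span => v; case: b => [[|u [|w []]]] //= _; rewrite !inE orbC. Qed.

Lemma plucker_swap b : plucker (swap_basis b) = - plucker b.
Proof. by rewrite /plucker /wedge /= opprB. Qed.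

Lemma opposite_ex l : exists2 m, forget m = forget l & pl m = - pl l.
Proof.
have [b lb] := orientation_ex l; have bU := orientation_basis lb.
have sU : basis_of (\val (forget l)) (swap_basis b).
  by rewrite basis_line swap_basis_span (span_basis bU).
exists (frame_oline sU) => //.
by rewrite (plE (frame_olineP sU)) (plE lb) plucker_swap /normalize normrN scalerN.
Qed.

Lemma plucker_gl g b :
  plucker (gl_basis g b) = gl_mx g *m plucker b *m (gl_mx g)^T.
Proof.
rewrite mul_wedge /plucker !(nth_map 0) ?size_tuple //.
by rewrite !gl_funE.
Qed.

Lemma orientation_gl g l b : orientation l b ->
  orientation (gl_oline g l) (gl_basis g b).
Proof. by exists b. Qed.

Lemma pl_gl g : pl (gl_oline g (base_oline R)) =
  normalize (gl_mx g *m plucker (base_basis R) *m (gl_mx g)^T).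
Proof.
rewrite -plucker_gl; apply: plE; apply: orientation_gl.
rewrite /= orientation_classE; last by rewrite /basis_of eqxx base_basis_free.
split; first by rewrite /basis_of eqxx base_basis_free.
by exists 1; rewrite ?scale1r.
Qed.

End Wedge.

(** * The topology of the space of oriented lines *)

Section MatrixLimits.
Variables (R : realType) (T : Type) (F : set_system T).
Context {FF : Filter F}.

Lemma cvg_mx m n (f : T -> 'M[R]_(m, n)) (M : 'M[R]_(m, n)) :
  (forall i j, f x i j @[x --> F] --> M i j) -> f x @[x --> F] --> M.
Proof.
move=> fM A [P MP PA]; apply: filterS (fun x => PA (f x)) _.
by do 2 (apply: filter_forall => ?); exact/fM/MP.
Qed.

Lemma cvg_coord m n (f : T -> 'M[R]_(m, n)) (M : 'M[R]_(m, n)) i j :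
  f x @[x --> F] --> M -> f x i j @[x --> F] --> M i j.
Proof. by move=> fM; exact: (cvg_comp _ _ fM (@coord_continuous _ _ _ i j M)). Qed.

Lemma cvg_mulmx m n p (f : T -> 'M[R]_(m, n)) (g : T -> 'M[R]_(n, p))
    (M : 'M[R]_(m, n)) (N : 'M[R]_(n, p)) :
  f x @[x --> F] --> M -> g x @[x --> F] --> N ->
  f x *m g x @[x --> F] --> M *m N.
Proof.
move=> fM gN; apply: cvg_mx => i j; rewrite mxE.
under eq_fun do rewrite mxE.
apply: cvg_big => [|k _]; first exact: add_continuous.
by apply: cvgM; exact: cvg_coord.
Qed.

Lemma cvg_trmx m n (f : T -> 'M[R]_(m, n)) (M : 'M[R]_(m, n)) :
  f x @[x --> F] --> M -> (f x)^T @[x --> F] --> M^T.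
Proof.
move=> fM; apply: cvg_mx => i j; rewrite mxE.
by under eq_fun do rewrite mxE; exact: cvg_coord.
Qed.

Lemma cvg_det n (f : T -> 'M[R]_n) (M : 'M[R]_n) :
  f x @[x --> F] --> M -> \det (f x) @[x --> F] --> \det M.
Proof.
move=> fM; apply: cvg_big => [|s _]; first exact: add_continuous.
apply: cvgM; first exact: cvg_cst.
apply: cvg_big => [|i _]; first exact: mul_continuous.
exact: cvg_coord.
Qed.

Lemma cvg_normalize (f : T -> 'M[R]_4) (M : 'M[R]_4) : M != 0 ->
  f x @[x --> F] --> M -> normalize (f x) @[x --> F] --> normalize M.
Proof.
move=> M0 fM; apply: cvgZ => //; apply: cvgV; first by rewrite normr_eq0.
exact: cvg_norm.
Qed.

End MatrixLimits.

Section OrientedLineTopology.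
Variable R : realType.
Notation V := 'cV[R]_4.
Implicit Types (l m : oline R) (L : line R).

(** [PGL] carries the quotient topology of [GL], so openness can be tested on matrices instead of
    their classes. *)
Lemma oline_openE (A : set (oline R)) :
  open A = open [set g : GL R | A (gl_oline g (base_oline R))].
Proof.
transitivity (oline_open A) => //; rewrite /oline_open.
have -> : [set g : GL R | A (gl_oline g (base_oline R))] =
    \pi_(PGL R)%qT @^-1` [set q : PGL R | A (pgl_oline q (base_oline R))].
  by apply/funext => g; rewrite /= pgl_olineE.
by [].
Qed.

Lemma gl_mx_continuous : continuous (@gl_mx R).
Proof. exact: initial_continuous. Qed.

Lemma pl_continuous : continuous (@pl R).
Proof.
apply/continuousP => A oA; rewrite oline_openE.
have -> : [set g | (@pl R @^-1` A) (gl_oline g (base_oline R))] =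
  (fun g : GL R => normalize (gl_mx g *m plucker (base_basis R) *m (gl_mx g)^T)) @^-1` A.
  by apply/funext => g; rewrite /= pl_gl.
move: A oA; apply/continuousP => g.
(* The neighbourhood filter is replaced by an arbitrary filter of which only the convergence of
   [gl_mx] is known. *)
suff H (F : set_system (GL R)) (FF : Filter F) : gl_mx x @[x --> F] --> gl_mx g ->
    normalize (gl_mx x *m plucker (base_basis R) *m (gl_mx x)^T) @[x --> F] -->
    normalize (gl_mx g *m plucker (base_basis R) *m (gl_mx g)^T).
  exact: H (@gl_mx_continuous g).
move=> c; apply: cvg_normalize; last first.
  by apply: cvg_mulmx; [apply: cvg_mulmx => //; exact: cvg_cst|exact: cvg_trmx].
rewrite -plucker_gl; apply: plucker_neq0.
apply: (@basis_free _ _ (gl_fun g @: <<base_basis R>>)%VS).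
by apply: gl_basis_of; rewrite /basis_of eqxx base_basis_free.
Qed.

Lemma gl_oline_frame g l : orientation l (gl_basis g (base_basis R)) ->
  gl_oline g (base_oline R) = l.
Proof.
apply: orientation_inj; apply: orientation_gl.
rewrite /= orientation_classE; last by rewrite /basis_of eqxx base_basis_free.
split; first by rewrite /basis_of eqxx base_basis_free.
by exists 1; rewrite ?scale1r.
Qed.

Lemma gl_nbhs (g : GL R) (A : set (GL R)) : nbhs g A ->
  nbhs (gl_mx g) [set M | forall h : GL R, gl_mx h = M -> A h].
Proof.
case=> _ [[W oW <-] Wg WA]; apply: filterS (open_nbhs_nbhs (conj oW Wg)).
by move=> M WM h hM; apply: WA; rewrite -hM in WM.
Qed.

(** This makes [pl] open onto its image. Near [l0] the orbit map has a section that depends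
    continuously on the Pluecker matrix. *)
Lemma oline_nbhs l0 (A : set (oline R)) : nbhs l0 A ->
  nbhs (pl l0) [set M | forall l, pl l = M -> A l].
Proof.
rewrite nbhsE => -[B [oB Bl0] BA].
suff : nbhs (pl l0) [set M | forall l, pl l = M -> B l].
  by apply: filterS => M BM l /BM /BA.
have [b bl0] := orientation_ex l0.
have bU := orientation_basis bl0; have bf := basis_free bU.
have [g gb] := extend_frame bf.
have gl0 : gl_oline g (base_oline R) = l0 by apply: gl_oline_frame; rewrite gb.
rewrite oline_openE in oB.
have /gl_nbhs Wg : nbhs g [set h : GL R | B (gl_oline h (base_oline R))].
  by apply: open_nbhs_nbhs; split => //=; rewrite gl0.
have [x0 [x1 [e0 e1 e01]]] := plucker_solve bf.
set M0 := plucker b in e0 e1 e01.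
have [c c0 M0E] := pl_plucker bl0; rewrite -/M0 in M0E.
pose a0 := (base_basis R)`_0; pose a1 := (base_basis R)`_1.
(* [Y] sends [a0], [a1] to [x0], [x1]. Hence [G M] below sends them to [c *: (M *m x0)] and
   [c *: (M *m x1)], which are vectors of [l] when [M = pl l]. *)
pose Y := x0 *m a0^T + x1 *m a1^T.
(* [G] is a local section of the orbit map: the first two columns of
   [G (pl l)] span [l] whenever [l] is close to [l0]. *)
pose G (M : 'M[R]_4) := gl_mx g + (c *: M - M0) *m Y.
have GM0 : G (pl l0) = gl_mx g by rewrite /G -M0E subrr mul0mx addr0.
have Gc : G x @[x --> pl l0] --> gl_mx g.
  suff H (F : set_system 'M[R]_4) (FF : Filter F) :
      x @[x --> F] --> pl l0 -> G x @[x --> F] --> G (pl l0).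
    by rewrite -GM0; apply: (H (nbhs (pl l0))); exact: cvg_id.
  move=> Fl0; apply: cvgD; first exact: cvg_cst.
  apply: cvg_mulmx; last exact: cvg_cst.
  by apply: cvgB; [apply: cvgZr|exact: cvg_cst].
have d := base_basis_dot R.
have Y0 : Y *m a0 = x0.
  rewrite mulmxDl -!mulmxA (d 0 0) (d 1 0) /= !mul_mx_scalar scale1r scale0r.
  by rewrite addr0.
have Y1 : Y *m a1 = x1.
  rewrite mulmxDl -!mulmxA (d 0 1) (d 1 1) /= !mul_mx_scalar scale1r scale0r.
  by rewrite add0r.
near=> M => l lM.
have Gu : G M \in [set h : 'M[R]_4 | h \in unitmx].
  rewrite inE /= unitmxE unitfE; near: M.
  apply: (cvgr_neq0 _ (cvg_det Gc)).
  by rewrite -unitfE -unitmxE gl_unit.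
pose h : GL R := SigSub Gu.
(* The value at [pl l0] is [c^-1]. Positivity nearby guarantees that the frame built from [M] has
   the orientation of [l], not the opposite one. *)
have x01 : 0 < (x0^T *m M *m x1) 0 0.
  near: M; apply: (cvgr_gt (c^-1)); last by rewrite invr_gt0.
  have -> : c^-1 = (x0^T *m pl l0 *m x1) 0 0.
    move: e01; rewrite M0E -scalemxAr -scalemxAl mxE => /(canRL (mulKf _)) ->.
      by rewrite mulr1.
    by rewrite gt_eqF.
  apply: cvg_coord; apply: cvg_mulmx; last exact: cvg_cst.
  by apply: cvg_mulmx => //; exact: cvg_cst.
suff <- : gl_oline h (base_oline R) = l.
  have : [set M | forall h : GL R, gl_mx h = M -> B (gl_oline h (base_oline R))] (G M).
    near: M; exact: Gc Wg.
  exact.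
apply: gl_oline_frame.
have hE (i : 'I_2) x : Y *m (base_basis R)`_i = x -> M0 *m x = b`_i ->
    gl_mx h *m (base_basis R)`_i = c *: (M *m x).
  move=> Yx Mx; rewrite -[gl_mx h]/(G M) mulmxDl -mulmxA Yx mulmxBl Mx -gb.
  rewrite [X in _ - X](nth_map 0) ?size_tuple // gl_funE addrC subrK.
  by rewrite scalemxAl.
have hf : free (gl_basis h (base_basis R)).
  apply: (@basis_free _ _ (gl_fun h @: <<base_basis R>>)%VS).
  by apply: gl_basis_of; rewrite /basis_of eqxx base_basis_free.
apply: (pl_orientation (c := c ^+ 2 * (x0^T *m M *m x1) 0 0)) => //.
  by rewrite mulr_gt0 // exprn_gt0.
rewrite /plucker !(nth_map 0) ?size_tuple // !gl_funE (hE 0 x0 Y0 e0) (hE 1 x1 Y1 e1).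
rewrite -!lM -scalerA -pl_image.
by rewrite wedgeZ.
Unshelve. all: by end_near.
Qed.

Lemma pl_ball l (e : R) : 0 < e -> nbhs l [set m | `|pl l - pl m| < e].
Proof.
move=> e0; have := @pl_continuous l _ (nbhsx_ballx (pl l) e e0).
by rewrite -ball_normE.
Qed.

Definition pl_dist l m : R := `|pl l - pl m|.

Lemma pl_dist_metrizes : metrizes pl_dist.
Proof.
split=> [l m|l m|l m n|l A].
- split=> [/normr0_eq0/subr0_eq/pl_inj//|->].
  by rewrite /pl_dist subrr normr0.
- by rewrite /pl_dist distrC.
- by rewrite /pl_dist -[pl l - pl n](subrKA (pl m)) ler_normD.
split=> [/oline_nbhs/nbhs_ballP[e e0 eA]|[e e0 eA]].
  exists e => // m /=; rewrite /pl_dist => lm; apply: eA erefl.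
  by rewrite -ball_normE.
exact: filterS eA (pl_ball l e0).
Qed.

(** [forget] carries the orbit map at [base_oline] to the one at [base_line], so a set of lines and
    its preimage are open by the same condition. *)
Lemma forget_continuous : continuous (@forget R).
Proof. by apply/continuousP => A oA; exact: oA. Qed.

Lemma forget_open l (A : set (oline R)) :
  nbhs l A -> nbhs (forget l) (@forget R @` A).
Proof.
rewrite nbhsE => -[B [oB Bl] BA].
suff oF : open (@forget R @` B).
  apply: filterS (open_nbhs_nbhs (conj oF _)); first exact: image_subset.
  by exists l.
have oN : open [set m | exists2 m', B m' & pl m = - pl m'].
  rewrite openE => m [m' Bm' mm'].
  have /oline_nbhs/nbhs_ballP[e e0 eB] : nbhs m' B by exact: open_nbhs_nbhs.
  apply: filterS (pl_ball m e0) => k /= mk.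
  have [k' _ kk'] := opposite_ex k.
  exists k'; last by rewrite kk' opprK.
  by apply: eB erefl; rewrite -ball_normE /= kk' opprK -[pl m']opprK -mm' addrC distrC.
have -> : open (@forget R @` B) =
    open (B `|` [set m | exists2 m', B m' & pl m = - pl m']).
  transitivity (open (@forget R @^-1` (@forget R @` B))) => //.
  congr open; apply/seteqP; split=> [m [m' Bm' mm']|m].
    by have [pm|pm] := forget_pl mm'; [left; rewrite (pl_inj pm)|right; exists m'].
  case=> [Bm|[m' Bm' mm']]; first by exists m.
  by exists m' => //; apply/esym/(@pl_forget _ _ _ (-1)); rewrite scaleN1r.
exact: openU.
Qed.

Lemma forget_nbhs l (A : set (line R)) :
  nbhs (forget l) A <-> nbhs l (@forget R @^-1` A).
Proof.
split=> [|/forget_open]; first exact: forget_continuous.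
by apply: filterS => _ [m Am <-].
Qed.

End OrientedLineTopology.

(** * Homeomorphisms and connectedness *)

Section CompactHausdorff.
Variables (X Y : topologicalType) (A : set X) (B : set Y) (f : X -> Y).

Lemma compact_homeomorphism (x0 : X) : compact A -> hausdorff_space Y ->
  set_bij A B f -> {within A, continuous f} -> homeomorphism_on A B f.
Proof.
move=> cA hY bf cf; split=> //; have [fAB fi fs] := bf.
pose g y := xget x0 [set x | A x /\ f x = y].
have gP y : B y -> A (g y) /\ f (g y) = y.
  by move=> /fs[x Ax fx]; rewrite /g; case: xgetP => [//|/(_ x)]; case.
have gK x : A x -> g (f x) = x.
  move=> Ax; have [Ag fg] := gP _ (fAB _ Ax).
  by apply: fi; rewrite ?inE.
exists g; first by move=> x; rewrite inE; exact: gK.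
apply/subspace_continuousP => y By U; rewrite /= nbhsE => -[V [oV Vy] VU].
have cAV : compact (A `&` ~` V) by apply: compact_closedI => //; exact: open_closedC.
have : compact (f @` (A `&` ~` V)).
  apply: continuous_compact cAV; apply: continuous_subspaceW cf.
  by move=> x [].
move=> /(compact_closed hY) cf'.
have nf : ~ (f @` (A `&` ~` V)) y.
  by move=> [x [Ax nVx] fx]; apply: nVx; rewrite -(gK x Ax) fx.
apply: filterS (open_nbhs_nbhs (conj (closed_openC cf') nf)) => z nfz Bz.
apply: VU; apply: contrapT => nV; apply: nfz.
by have [Ag fg] := gP _ Bz; exists (g z).
Qed.

End CompactHausdorff.

(** * Connectedness of the sphere and of the sphere without its poles *)

Section Connected.
Variable R : realType.

Lemma star_shaped_connected (V : normedModType R) (A : set V) (c : V) :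
  (forall x (t : R), A x -> 0 <= t <= 1 -> A (c + t *: (x - c))) -> connected A.
Proof.
move=> cA; have -> : A = \bigcup_(x in A) [set c + t *: (x - c) | t in `[0%R, 1%R]%classic].
  apply/seteqP; split=> [x Ax|_ [x Ax [t t01 <-]]].
    exists x => //; exists 1; first by rewrite /= in_itv /= ler01 lexx.
    by rewrite scale1r addrC subrK.
  by apply: cA => //; move: t01; rewrite /= in_itv.
apply: bigcup_connected.
  exists c => x Ax; exists 0; first by rewrite /= in_itv /= ler01 lexx.
  by rewrite scale0r addr0.
move=> x Ax; apply: connected_continuous_connected; first exact: segment_connected.
apply: continuous_subspaceT => t.
by apply: cvgD; [exact: cvg_cst|apply: cvgZl].
Qed.

Definition halfspace (i : 'I_3) (e : R) : set 'rV[R]_3 := [set x | 0 < e * x 0 i].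

Lemma halfspace_connected i e : e != 0 -> connected (halfspace i e).
Proof.
move=> e0; apply: (@star_shaped_connected _ _ (const_mx e)) => x t /=.
rewrite /halfspace /= !mxE => x0 /andP[t0 t1].
have : 0 < e * e by rewrite -expr2 exprn_even_gt0.
have -> : e * (e + t * (x 0 i - e)) = (1 - t) * (e * e) + t * (e * x 0 i) by ring.
move: x0; move: (e * e) (e * x 0 i) => a b b0 a0.
have [->|t1'] := eqVneq t 1; first by rewrite subrr mul0r add0r mul1r.
have ht : 0 < 1 - t by rewrite subr_gt0 lt_neqAle t1'.
by rewrite ltr_pwDl ?mulr_gt0 ?mulr_ge0 // ltW.
Qed.

(** On the sphere this removes the two poles, which will be the images of [W] and [X]. *)
Definition off_axis : set 'rV[R]_3 := [set x | (x 0 0 != 0) || (x 0 1 != 0)].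

(** Four open half-spaces cover the set, and each of them meets the union of those before it. *)
Lemma off_axis_connected : connected off_axis.
Proof.
have -> : off_axis = halfspace 0 1 `|` halfspace 1 1 `|` halfspace 0 (-1) `|` halfspace 1 (-1).
  apply/seteqP; split=> x; rewrite /off_axis /halfspace /= !(mul1r, mulN1r, oppr_gt0).
    by case/orP; rewrite neq_lt => /orP[]; tauto.
  by case=> [[[]|]|] h; apply/orP; [left|right|left|right]; rewrite ?(gt_eqF h) ?(lt_eqF h).
have o0 : (1 : R) != 0 by exact: oner_neq0.
have n0 : (-1 : R) != 0 by rewrite oppr_eq0.
pose pt (a b : R) : 'rV[R]_3 := \row_i [:: a; b; 0]`_i.
apply: connectedU; last exact: halfspace_connected.
  exists (pt (-1) (-1)); rewrite /halfspace /= !mxE /=; split; [right|]; lra.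
apply: connectedU; last exact: halfspace_connected.
  exists (pt (-1) 1); rewrite /halfspace /= !mxE /=; split; [right|]; lra.
apply: connectedU; try exact: halfspace_connected.
by exists (pt 1 1); rewrite /halfspace /= !mxE /=; split; lra.
Qed.

Lemma punctured_connected : connected [set x : 'rV[R]_3 | x != 0].
Proof.
have o0 : (1 : R) != 0 by exact: oner_neq0.
have n0 : (-1 : R) != 0 by rewrite oppr_eq0.
have -> : [set x : 'rV[R]_3 | x != 0] =
    off_axis `|` halfspace ord_max 1 `|` halfspace ord_max (-1).
  apply/seteqP; split=> x; rewrite /off_axis /halfspace /= !(mul1r, mulN1r, oppr_gt0).
    move=> x0; have [e0|] := eqVneq (x 0 0) 0; last by left; left.
    have [e1|] := eqVneq (x 0 1) 0; last by left; left.
    have : x 0 ord_max != 0.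
      apply: contra_neq x0 => e2; apply/rowP => -[[|[|[|//]]] h]; rewrite mxE;
        [rewrite -e0|rewrite -e1|rewrite -e2]; congr (x _ _); exact: val_inj.
    by rewrite neq_lt => /orP[]; tauto.
  move=> H; apply/eqP => x0; move: H; rewrite x0 !mxE eqxx ltxx /=.
  by case=> [[]|].
pose pt (a b : R) : 'rV[R]_3 := \row_i [:: a; 0; b]`_i.
apply: connectedU; last exact: halfspace_connected.
  exists (pt 1 (-1)); rewrite /off_axis /halfspace /= !mxE /= oner_neq0.
  by split; [left|lra].
apply: connectedU; [|exact: off_axis_connected|exact: halfspace_connected].
by exists (pt 1 1); rewrite /off_axis /halfspace /= !mxE /= oner_neq0; split => //; lra.
Qed.

Definition sqnorm (x : 'rV[R]_3) : R := \sum_i x 0 i ^+ 2.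

Lemma sqnorm_gt0 x : x != 0 -> 0 < sqnorm x.
Proof.
move=> x0; rewrite lt_neqAle sumr_ge0 ?andbT => [|i _]; last exact: sqr_ge0.
apply: contra_neq x0 => /esym/psumr_eq0P x0; apply/rowP => i; rewrite mxE.
by apply/eqP; rewrite -sqrf_eq0 x0 // => j _; exact: sqr_ge0.
Qed.

(** The set is the image of [A] under the radial projection [nu], which is continuous away from
    [0]. *)
Lemma sphere_cone_connected (A : set 'rV[R]_3) : A `<=` [set x | x != 0] -> connected A ->
  (forall x (t : R), 0 < t -> A x -> A (t *: x)) ->
  connected (@unit_sphere2 R `&` A).
Proof.
move=> A0 cA At; pose nu (x : 'rV[R]_3) := (Num.sqrt (sqnorm x))^-1 *: x.
have -> : @unit_sphere2 R `&` A = nu @` A.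
  apply/seteqP; split=> [x [x1 Ax]|_ [x Ax <-]].
    by exists x => //; rewrite /nu /sqnorm x1 sqrtr1 invr1 scale1r.
  have x0 := sqnorm_gt0 (A0 _ Ax); split; last first.
    by apply: At => //; rewrite invr_gt0 sqrtr_gt0.
  rewrite /unit_sphere2 /=.
  under eq_bigr do rewrite mxE exprMn.
  by rewrite -mulr_sumr exprVn sqr_sqrtr ?mulVf ?gt_eqF // ltW.
apply: connected_continuous_connected cA _; apply/subspace_continuousP => x Ax.
apply: cvg_within_filter.
have x0 := sqnorm_gt0 (A0 _ Ax).
suff H (F : set_system 'rV[R]_3) (FF : Filter F) :
    x @[x --> F] --> x -> nu x @[x --> F] --> nu x.
  by apply: (H (nbhs x)); exact: cvg_id.
move=> Fx; apply: cvgZ => //; apply: cvgV; first by rewrite gt_eqF // sqrtr_gt0.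
have sq : sqnorm y @[y --> F] --> sqnorm x.
  apply: cvg_big => [|i _]; first exact: add_continuous.
  by apply: cvgM; exact: cvg_coord.
exact: (cvg_comp _ _ sq (@sqrt_continuous R (sqnorm x))).
Qed.

Lemma sphere_connected : connected (@unit_sphere2 R).
Proof.
have -> : @unit_sphere2 R = @unit_sphere2 R `&` [set x | x != 0].
  apply/esym/setIidPl => x x1; apply/eqP => x0; move: x1.
  rewrite /unit_sphere2 /= x0; under eq_bigr do rewrite mxE expr0n.
  by rewrite big1 // => /eqP; rewrite eq_sym oner_eq0.
apply: sphere_cone_connected => //; first exact: punctured_connected.
by move=> x t t0 /= x0; rewrite scaler_eq0 negb_or x0 gt_eqF.
Qed.

Lemma sphere_off_axis_connected : connected (@unit_sphere2 R `&` off_axis).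
Proof.
apply: sphere_cone_connected; last 1 first.
- by move=> x t t0; rewrite /off_axis /= !mxE !mulf_eq0 (gt_eqF t0).
- by move=> x; rewrite /off_axis /=; apply: contraTneq => ->; rewrite !mxE eqxx.
- exact: off_axis_connected.
Qed.

End Connected.

(** * A compact spread is a sphere missing a linear complex *)

Section PluckerCoordinates.
Variable R : realType.
Notation V := 'cV[R]_4.
Implicit Types (l m : oline R) (L : line R) (v x y : V).

Lemma pl_mem l x : pl l *m x \in \val (forget l).
Proof.
have [b lb] := orientation_ex l.
rewrite (plE lb) -scalemxAl -(span_basis (orientation_basis lb)).
by rewrite memvZ // plucker_mem.
Qed.

Lemma pl_onto l v : v \in \val (forget l) -> exists y, v = pl l *m y.
Proof.
have [b lb] := orientation_ex l; have bU := orientation_basis lb.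
have [x0 [x1 [e0 e1 _]]] := plucker_solve (basis_free bU).
have [c _ e] := pl_plucker lb.
rewrite -(span_basis bU) => /coord_span ->.
rewrite !big_ord_recl big_ord0 addr0 /= -[b`_0]e0 -[b`_1]e1 e.
exists (coord b ord0 v *: (c *: x0) + coord b (lift ord0 ord0) v *: (c *: x1)).
by rewrite mulmxDr -!scalemxAr -!scalemxAl.
Qed.

Lemma pl_tr l : (pl l)^T = - pl l.
Proof.
have [u [v ->]] := pl_wedge l; apply/matrixP => i j.
by rewrite mxE [RHS]mxE !wedgeE; ring.
Qed.

Lemma pl_annihilate l x v : pl l *m x = 0 -> v \in \val (forget l) -> x^T *m v = 0.
Proof.
move=> lx /pl_onto[y ->]; apply: trmx_inj.
by rewrite !trmx_mul trmxK pl_tr trmx0 mulmxN mulNmx -mulmxA lx mulmx0 oppr0.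
Qed.

Lemma line_neq0 L : exists2 v, v != 0 & v \in \val L.
Proof.
exists (vpick (\val L)); last exact: memv_pick.
by rewrite vpick0 -dimv_eq0 (eqP (valP L)).
Qed.

(** Read [x] and [y] as linear forms. [pl l *m y] is a common zero on the line, by the hypothesis
    and by skewness; so is [pl l *m x] if the first vector vanishes. If both vanish, both forms are
    zero on the whole line. *)
Lemma pl_meet l x y : x^T *m pl l *m y = 0 ->
  exists v, [/\ v != 0, v \in \val (forget l), x^T *m v = 0 & y^T *m v = 0].
Proof.
have sk (z : V) : z^T *m (pl l *m z) = 0.
  have [u [v ->]] := pl_wedge l; rewrite wedge_apply mulmxBr -!scalemxAr.
  apply/matrixP => i j; rewrite !ord1 !mxE.
  have tr (w : V) : \sum_j w^T 0 j * z j 0 = \sum_j z^T 0 j * w j 0.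
    by apply: eq_bigr => h _; rewrite !mxE mulrC.
  by rewrite !tr; ring.
move=> xy; have [ly|ly] := eqVneq (pl l *m y) 0; last first.
  by exists (pl l *m y); rewrite pl_mem mulmxA xy sk.
have [lx|lx] := eqVneq (pl l *m x) 0; last first.
  by exists (pl l *m x); rewrite pl_mem sk (pl_annihilate ly (pl_mem l x)).
have [v v0 vl] := line_neq0 (forget l).
by exists v; rewrite (pl_annihilate lx) // (pl_annihilate ly).
Qed.

Lemma cV4P (y y' : V) : y 0 0 = y' 0 0 -> y 1 0 = y' 1 0 ->
  y 2%:R 0 = y' 2%:R 0 -> y 3%:R 0 = y' 3%:R 0 -> y = y'.
Proof.
move=> e0 e1 e2 e3; apply/colP => -[[|[|[|[|//]]]] h].
- by have -> : Ordinal h = 0 by exact: val_inj.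
- by have -> : Ordinal h = 1 by exact: val_inj.
- by have -> : Ordinal h = 2%:R by exact: val_inj.
- by have -> : Ordinal h = 3%:R by exact: val_inj.
Qed.

Lemma oppmxE p q (M : 'M[R]_(p, q)) i j : (- M) i j = - M i j.
Proof. by rewrite mxE. Qed.

Lemma colmxE p q (M : 'M[R]_(p, q)) i j : col j M i 0 = M i j.
Proof. by rewrite mxE. Qed.

Variable g : GL R.
Let k := invmx (gl_mx g).

(** The Pluecker matrix of [l] in the coordinates [k *m v] of the frame [g]. *)
Definition chart l : 'M[R]_4 := k *m pl l *m k^T.

Let gK x : k *m (gl_mx g *m x) = x. Proof. by rewrite mulKmx ?gl_unit. Qed.
Let kK x : gl_mx g *m (k *m x) = x. Proof. by rewrite mulKVmx ?gl_unit. Qed.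

Lemma chart_skew l i j : chart l i j = - chart l j i.
Proof.
have E : chart l = - (chart l)^T by rewrite /chart !trmx_mul trmxK pl_tr mulNmx mulmxN opprK mulmxA.
by rewrite {1}E mxE [X in - X]mxE.
Qed.

Lemma chart_diag l i : chart l i i = 0.
Proof. have := chart_skew l i i; lra. Qed.

(** The [i]-th coordinate functional of the frame, written as a vector. *)
Let form (i : 'I_4) : V := k^T *m delta_mx i 0.

Let formE i v : (form i)^T *m v = (k *m v) i 0 *: 1%:M.
Proof.
rewrite trmx_mul trmxK trmx_delta -mulmxA -rowE; apply/matrixP => a b.
by rewrite !ord1 !mxE mulr1.
Qed.

Let col_chart l j : gl_mx g *m col j (chart l) = pl l *m form j.
Proof. by rewrite colE /chart -!mulmxA kK. Qed.

Lemma chart_mem l j : gl_mx g *m col j (chart l) \in \val (forget l).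
Proof. by rewrite col_chart pl_mem. Qed.

Let chartE l i j : chart l i j = ((form i)^T *m pl l *m form j) 0 0.
Proof. by rewrite -mulmxA formE -col_chart gK !mxE mulr1. Qed.

Lemma chart_meet l i j : chart l i j = 0 -> exists v,
  [/\ v != 0, v \in \val (forget l), (k *m v) i 0 = 0 & (k *m v) j 0 = 0].
Proof.
rewrite chartE => ij0.
have /pl_meet[v [v0 vl iv jv]] : (form i)^T *m pl l *m form j = 0.
  by apply/matrixP => a b; rewrite !ord1 ij0 mxE.
exists v; split=> //.
  by move: iv; rewrite formE => /eqP; rewrite scaler_eq0 oner_eq0 orbF => /eqP.
by move: jv; rewrite formE => /eqP; rewrite scaler_eq0 oner_eq0 orbF => /eqP.
Qed.

Lemma chart_vanish l i j :
  (forall v, v \in \val (forget l) -> (k *m v) i 0 = 0) -> chart l i j = 0.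
Proof. by move=> h; rewrite chartE -mulmxA formE h ?pl_mem // scale0r mxE. Qed.

Lemma chart_wedge l : exists u v, chart l = wedge u v.
Proof.
have [u [v lE]] := pl_wedge l; exists (k *m u), (k *m v).
by rewrite /chart lE mul_wedge.
Qed.

(** The form [h] vanishes at [v], so by [pl_image] the vector [pl l *m form h] and [v] have wedge
    zero; the claim is an entry of that wedge in coordinates. *)
Lemma chart_collinear l v i j h : v \in \val (forget l) -> (k *m v) h 0 = 0 ->
  chart l i h * (k *m v) j 0 = chart l j h * (k *m v) i 0.
Proof.
move=> /pl_onto[y vE] vh0.
have W : wedge (pl l *m form h) v = 0.
  by rewrite vE pl_image -mulmxA -vE formE vh0 scale0r mxE scale0r.
have := congr1 (fun M => (k *m M *m k^T) i j) W.
rewrite mul_wedge wedgeE mulmx0 mul0mx [RHS]mxE -col_chart gK.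
rewrite ![col _ _ _ _]mxE => /subr0_eq ->.
by rewrite mulrC.
Qed.

Lemma forget_chart l m : forget l = forget m ->
  chart m = chart l \/ chart m = - chart l.
Proof.
by move=> /forget_pl[] e; [left|right]; rewrite /chart e // mulmxN mulNmx.
Qed.

Lemma chart_cvg l i j : chart m i j @[m --> l] --> chart l i j.
Proof.
apply: cvg_coord.
suff H (F : set_system (oline R)) (FF : Filter F) :
    pl m @[m --> F] --> pl l -> chart m @[m --> F] --> chart l.
  by apply: (H (nbhs l)); exact: pl_continuous.
by move=> c; apply: cvg_mulmx; [apply: cvg_mulmx => //|]; exact: cvg_cst.
Qed.

End PluckerCoordinates.

(** * Stereographic projection in homogeneous coordinates *)

Section Stereographic.
Variable R : realType.
Implicit Types a b c t : R.

(* Inverse stereographic projection in homogeneous coordinates; because division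
   by [0] gives [0], the value at [(0, 0, 0)] is the pole [(0, 0, 1)]. *)
Definition stereo a b c : 'rV[R]_3 :=
  let D := a ^+ 2 + b ^+ 2 + c ^+ 2 in
  \row_i [:: 2 * (a * c / D); 2 * (b * c / D); 1 - 2 * (c * c / D)]`_i.

Lemma rV3P (s s' : 'rV[R]_3) :
  s 0 0 = s' 0 0 -> s 0 1 = s' 0 1 -> s 0 2%:R = s' 0 2%:R -> s = s'.
Proof.
move=> e0 e1 e2; apply/rowP => -[[|[|[|//]]] h].
- by have -> : Ordinal h = 0 by exact: val_inj.
- by have -> : Ordinal h = 1 by exact: val_inj.
- by have -> : Ordinal h = 2%:R by exact: val_inj.
Qed.

Lemma rV3_sum (s : 'rV[R]_3) :
  \sum_i s 0 i ^+ 2 = s 0 0 ^+ 2 + s 0 1 ^+ 2 + s 0 2%:R ^+ 2.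
Proof.
rewrite !big_ord_recl big_ord0 addr0 addrA.
have -> : lift ord0 ord0 = 1 :> 'I_3 by exact: val_inj.
have -> : lift ord0 (lift ord0 ord0) = 2%:R :> 'I_3 by exact: val_inj.
by have -> : ord0 = 0 :> 'I_3 by exact: val_inj.
Qed.

Lemma sum_sq_eq0 a b c : (a ^+ 2 + b ^+ 2 + c ^+ 2 == 0) = [&& a == 0, b == 0 & c == 0].
Proof.
rewrite paddr_eq0 ?paddr_eq0 ?addr_ge0 ?sqr_ge0 //.
by rewrite !sqrf_eq0 andbA.
Qed.

Lemma stereo_sphere a b c : unit_sphere2 (stereo a b c).
Proof.
rewrite /unit_sphere2 /= rV3_sum !mxE /=.
have [D0|D0] := eqVneq (a ^+ 2 + b ^+ 2 + c ^+ 2) 0.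
  by rewrite D0 invr0; ring.
by field.
Qed.

Lemma stereo_scale t a b c : t != 0 -> stereo (t * a) (t * b) (t * c) = stereo a b c.
Proof.
move=> t0; have [D0|D0] := eqVneq (a ^+ 2 + b ^+ 2 + c ^+ 2) 0.
  move/eqP: D0; rewrite sum_sq_eq0 => /and3P[/eqP-> /eqP-> /eqP->].
  by rewrite !mulr0.
have DE : (t * a) ^+ 2 + (t * b) ^+ 2 + (t * c) ^+ 2 =
    t ^+ 2 * (a ^+ 2 + b ^+ 2 + c ^+ 2) by ring.
by apply: rV3P; rewrite !mxE /= DE; field; rewrite t0 D0.
Qed.

Lemma stereo_opp a b c : stereo (- a) (- b) (- c) = stereo a b c.
Proof. by rewrite /stereo !sqrrN !mulrNN. Qed.

Lemma stereo_pole a b : stereo a b 0 = stereo 0 0 0.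
Proof. by apply: rV3P; rewrite !mxE /= ?(mulr0, mul0r). Qed.

Lemma stereoK (s : 'rV[R]_3) : unit_sphere2 s -> s 0 2%:R != 1 ->
  stereo (s 0 0) (s 0 1) (1 - s 0 2%:R) = s.
Proof.
rewrite /unit_sphere2 /= rV3_sum.
move=> s1 s2.
have s2' : 1 - s 0 2%:R != 0 by rewrite subr_eq0 eq_sym.
have -> : stereo (s 0 0) (s 0 1) (1 - s 0 2%:R) = \row_i [:: s 0 0; s 0 1; s 0 2%:R]`_i.
  rewrite /stereo.
  have -> : s 0 0 ^+ 2 + s 0 1 ^+ 2 + (1 - s 0 2%:R) ^+ 2 = 2 * (1 - s 0 2%:R).
    by move: s1; move: (s 0 0) (s 0 1) (s 0 2%:R) => p q r; lra.
  by apply: rV3P; rewrite !mxE /=; field.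
by apply: rV3P; rewrite !mxE.
Qed.

Lemma stereo_inj a b c a' b' c' : c != 0 -> stereo a b c = stereo a' b' c' ->
  [/\ c' != 0, a / c = a' / c' & b / c = b' / c'].
Proof.
move=> c0 e.
have := congr1 (fun s : 'rV_3 => s 0 0) e; have := congr1 (fun s : 'rV_3 => s 0 1) e.
have := congr1 (fun s : 'rV_3 => s 0 2%:R) e; rewrite !mxE /=.
set D := _ + c ^+ 2; set D' := _ + c' ^+ 2 => e2 e1 e0.
have D0 : D != 0 by rewrite sum_sq_eq0 (negbTE c0) !andbF.
have {}e2 : c * c / D = c' * c' / D' by lra.
have {}e1 : b * c / D = b' * c' / D' by lra.
have {}e0 : a * c / D = a' * c' / D' by lra.
have cc : c * c / D != 0 by rewrite !mulf_neq0 ?invr_eq0.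
have c'0 : c' != 0.
  by apply: contra_neq cc => c'0; rewrite e2 c'0 !mul0r.
have D'0 : D' != 0 by rewrite sum_sq_eq0 (negbTE c'0) !andbF.
(* [a / c] is the quotient of [a * c / D] by [c * c / D], and the point of the sphere determines
   both. *)
have q (x y z : R) : y != 0 -> z != 0 -> x / y = (x * y / z) / (y * y / z).
  by move=> y0 z0; field; rewrite y0 z0.
by split=> //; rewrite (q _ c D) // (q _ c' D') // ?e0 ?e1 e2.
Qed.

Lemma stereo_off_axis a b c :
  off_axis (stereo a b c) <-> c != 0 /\ (a != 0) || (b != 0).
Proof.
rewrite /off_axis /= !mxE /=; set D := _ + c ^+ 2.
have [c0|c0] := eqVneq c 0.
  by rewrite c0 !mulr0 !mul0r !mulr0 eqxx; split=> [|[]].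
have D0 : D != 0 by rewrite sum_sq_eq0 (negbTE c0) !andbF.
clearbody D; rewrite !mulf_eq0 !invr_eq0 (negbTE D0) (negbTE c0) !orbF pnatr_eq0 /=.
by split=> [|[]].
Qed.

(** Both factors are at most the square root of the denominator; a zero denominator makes the
    quotient [0]. *)
Lemma stereo_bound a b c x y : x ^+ 2 <= a ^+ 2 + b ^+ 2 + c ^+ 2 ->
  y ^+ 2 <= a ^+ 2 + b ^+ 2 + c ^+ 2 -> `|x * y / (a ^+ 2 + b ^+ 2 + c ^+ 2)| <= 1.
Proof.
set D := _ + c ^+ 2 => xD yD; have : 0 <= D by rewrite !addr_ge0 ?sqr_ge0.
rewrite le_eqVlt => /orP[/eqP<-|D0]; first by rewrite invr0 mulr0 normr0.
rewrite normrM normfV (gtr0_norm D0) ler_pdivrMr // mul1r.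
rewrite -[leRHS](gtr0_norm D0) -ler_sqr ?nnegrE ?normr_ge0 // !real_normK ?num_real //.
by rewrite exprMn [leRHS]expr2 ler_pM ?sqr_ge0.
Qed.

End Stereographic.

(** * Frames adapted to two lines of a spread *)

Section SpreadSphere.
Variable R : realType.
Notation V := 'cV[R]_4.
Implicit Types (l m : oline R) (L : line R) (v x y : V).

Lemma line_frame L : exists g : GL R, forall v,
  (v \in \val L) = ((invmx (gl_mx g) *m v) 2%:R 0 == 0) && ((invmx (gl_mx g) *m v) 3%:R 0 == 0).
Proof.
have [l lL] := forget_surj L; have [b lb] := orientation_ex l.
have bL := orientation_basis lb; rewrite lL in bL.
have [g gb] := extend_frame (basis_free bL).
exists g => v; set k := invmx _; rewrite -(span_basis bL).
have bE (i : 'I_2) : b`_i = gl_mx g *m delta_mx (inord i) 0.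
  rewrite -gb -tnth_nth tnth_map gl_funE; congr (_ *m _).
  by case: i => [[|[|//]] h].
have i2 (i : 'I_2) (j : 'I_4) : (1 < j)%N -> (j == inord i) = false.
  move=> j1; rewrite -val_eqE /= inordK ?(ltn_trans (ltn_ord i)) //.
  by rewrite gtn_eqF // (leq_trans (ltn_ord i)).
apply/idP/andP => [/coord_span ->|[/eqP v2 /eqP v3]].
  rewrite !big_ord_recl big_ord0 addr0 !bE !mulmxDr -!scalemxAr !mulKmx ?gl_unit //.
  by rewrite !mxE !i2 // !mulr0 addr0 eqxx.
have -> : v = (k *m v) 0 0 *: b`_0 + (k *m v) 1 0 *: b`_1.
  rewrite (bE 0) (bE 1) !scalemxAr -mulmxDr -[LHS](mulKVmx (gl_unit g)); congr (_ *m _).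
  rewrite -/k; move: (k *m v) v2 v3 => y y2 y3.
  by apply: cV4P; rewrite !mxE -!val_eqE /= !inordK // ?y2 ?y3 ?(mulr0, mulr1, addr0, add0r).
by rewrite memvD // memvZ // memv_span // mem_nth // size_tuple.
Qed.

Definition meet_trivially L L' := forall v, v \in \val L -> v \in \val L' -> v = 0.

Lemma pair_frame W X : meet_trivially W X -> exists g : GL R,
  (forall v, (v \in \val W) =
    ((invmx (gl_mx g) *m v) 2%:R 0 == 0) && ((invmx (gl_mx g) *m v) 3%:R 0 == 0)) /\
  (forall v, (v \in \val X) =
    ((invmx (gl_mx g) *m v) 0 0 == 0) && ((invmx (gl_mx g) *m v) 1 0 == 0)).
Proof.
have [p pW] := line_frame W; have [q qX] := line_frame X.
move: pW qX; set a := invmx (gl_mx p); set b := invmx (gl_mx q) => pW qX WX.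
(* The rows are two equations of [X] followed by two equations of [W]; since the lines share only
   [0], [k] has trivial kernel. *)
pose k : 'M[R]_4 := \matrix_(i, j) [:: b 2%:R j; b 3%:R j; a 2%:R j; a 3%:R j]`_i.
have kE (v : V) : [/\ (k *m v) 0 0 = (b *m v) 2%:R 0, (k *m v) 1 0 = (b *m v) 3%:R 0,
    (k *m v) 2%:R 0 = (a *m v) 2%:R 0 & (k *m v) 3%:R 0 = (a *m v) 3%:R 0].
  by split; rewrite !mxE; apply: eq_bigr => j _; rewrite !mxE.
have ku : k \in unitmx.
  rewrite -unitmx_tr -row_free_unit; apply: inj_row_free => w wk.
  have kw : k *m w^T = 0 by apply: trmx_inj; rewrite trmx_mul trmxK wk trmx0.
  apply: trmx_inj; rewrite trmx0; have [e0 e1 e2 e3] := kE w^T.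
  by apply: WX; rewrite ?pW ?qX -?e0 -?e1 -?e2 -?e3 kw !mxE eqxx.
have gu : invmx k \in [set h : 'M[R]_4 | h \in unitmx] by rewrite inE /= unitmx_inv.
exists (SigSub gu); rewrite [gl_mx _]/(invmx k) invmxK.
by split=> v; have [e0 e1 e2 e3] := kE v; rewrite ?pW ?qX ?e0 ?e1 ?e2 ?e3.
Qed.

Variable C : set (line R).
Hypothesis hC : compact_spread C.

Lemma spread_uniq L L' v : C L -> C L' -> v != 0 ->
  v \in \val L -> v \in \val L' -> L = L'.
Proof.
case: hC => _ tC _ CL CL' v0 vL vL'; apply: tC => //.
have d1 : \dim <[v]>%VS == 1%N by rewrite dim_vline v0.
by exists (exist _ <[v]>%VS d1); split; rewrite /points_of /= -memvE.
Qed.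

Lemma spread_cover v : v != 0 -> exists2 L, C L & v \in \val L.
Proof.
case: hC => _ _ sC v0.
have d1 : \dim <[v]>%VS == 1%N by rewrite dim_vline v0.
have : [set: Defs.point R] (exist _ <[v]>%VS d1) by [].
by rewrite -sC => -[L CL vL]; exists L => //; rewrite memvE.
Qed.

Lemma spread_pair : exists W X, [/\ C W, C X & meet_trivially W X].
Proof.
have [w w0 _] := line_neq0 (base_line R); have [W CW _] := spread_cover w0.
have [g gW] := line_frame W; pose v : V := gl_mx g *m delta_mx 2%:R 0.
have nWv : v \notin \val W.
  by rewrite gW mulKmx ?gl_unit // !mxE eqxx oner_eq0.
have v0 : v != 0 by apply: contraNneq nWv => ->; rewrite mem0v.
have [X CX vX] := spread_cover v0.
exists W, X; split=> // u uW uX; apply: contraNeq nWv => u0.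
by rewrite (spread_uniq CW CX u0 uW uX).
Qed.

End SpreadSphere.

Section StereoLimits.
Variables (R : realType) (T : Type) (F : set_system T).
Context {FF : Filter F}.
Variables (a b c : T -> R) (a0 b0 c0 : R).
Hypotheses (ac : a x @[x --> F] --> a0) (bc : b x @[x --> F] --> b0)
  (cc : c x @[x --> F] --> c0).
Let D x := a x ^+ 2 + b x ^+ 2 + c x ^+ 2.
Let D0 := a0 ^+ 2 + b0 ^+ 2 + c0 ^+ 2.

Let stereo_cvgP : a x * c x / D x @[x --> F] --> a0 * c0 / D0 ->
  b x * c x / D x @[x --> F] --> b0 * c0 / D0 ->
  c x * c x / D x @[x --> F] --> c0 * c0 / D0 ->
  stereo (a x) (b x) (c x) @[x --> F] --> stereo a0 b0 c0.
Proof.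
move=> h1 h2 h3; apply: cvg_mx => i j; rewrite mxE.
under eq_fun do rewrite mxE.
case: j => [[|[|[|//]]] h] /=.
- by apply: cvgM => //; exact: cvg_cst.
- by apply: cvgM => //; exact: cvg_cst.
- by apply: cvgB; [exact: cvg_cst|apply: cvgM => //; exact: cvg_cst].
Qed.

Lemma stereo_cvg : D0 != 0 ->
  stereo (a x) (b x) (c x) @[x --> F] --> stereo a0 b0 c0.
Proof.
move=> D00; have Dc : D x @[x --> F] --> D0.
  by apply: cvgD; [apply: cvgD|]; apply: cvgM.
by apply: stereo_cvgP; (apply: cvgM; [exact: cvgM|exact: cvgV]).
Qed.

(* The last hypothesis will be the Pluecker relation: it makes [c] negligible
   against [a] and [b] although all three tend to [0]. *)
Lemma stereo_cvg_pole (e p q : T -> R) (e0 : R) :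
  c0 = 0 -> e0 != 0 -> e x @[x --> F] --> e0 ->
  p x @[x --> F] --> (0 : R) -> q x @[x --> F] --> (0 : R) ->
  (forall x, e x * c x = p x * b x - q x * a x) ->
  stereo (a x) (b x) (c x) @[x --> F] --> stereo a0 b0 c0.
Proof.
move=> c00 e00 ec pc qc E.
have aD x : a x ^+ 2 <= D x by rewrite /D -addrA lerDl addr_ge0 ?sqr_ge0.
have bD x : b x ^+ 2 <= D x by rewrite /D addrAC lerDr addr_ge0 ?sqr_ge0.
have cD x : c x ^+ 2 <= D x by rewrite /D lerDr addr_ge0 ?sqr_ge0.
(* By [E], [z * c / D] times [e] equals [p * (z * b / D) - q * (z * a / D)]. The bracketed quotients
   are bounded by [1], while [p] and [q] tend to [0]. *)
have small (z : T -> R) : (forall x, z x ^+ 2 <= D x) ->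
    z x * c x / D x @[x --> F] --> (0 : R).
  move=> zD; apply/norm_cvg0P.
  have bnd : (`|p x| + `|q x|) / `|e x| @[x --> F] --> (0 : R).
    have -> : (0 : R) = (`|0 : R| + `|0 : R|) / `|e0| by rewrite !normr0 addr0 mul0r.
    apply: cvgM; first by apply: cvgD; exact: cvg_norm.
    by apply: cvgV; [rewrite normr_eq0|exact: cvg_norm].
  apply: (squeeze_cvgr _ (cvg_cst 0) bnd).
  have ene : \forall x \near F, e x != 0 by exact: (cvgr_neq0 _ ec).
  apply: filterS ene => x ex; rewrite normr_ge0 /=.
  rewrite ler_pdivlMr ?normr_gt0 // -normrM.
  have -> : z x * c x / D x * e x = p x * (z x * b x / D x) - q x * (z x * a x / D x).
    transitivity (z x / D x * (e x * c x)); first by ring.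
    by rewrite E; ring.
  apply: le_trans (ler_normB _ _) _; rewrite !normrM lerD // ler_piMr // -!normrM.
    by apply: stereo_bound; rewrite -/(D x).
  by apply: stereo_bound; rewrite -/(D x).
by apply: stereo_cvgP; rewrite c00 mulr0 mul0r; exact: small.
Qed.

End StereoLimits.

(** * The homeomorphism onto the sphere and the nonvanishing combination *)

Section SpreadChart.
Variable R : realType.
Notation V := 'cV[R]_4.
Implicit Types (l m : oline R) (L : line R) (v x y : V).
Variables (C : set (line R)) (W X : line R) (g : GL R).
Hypotheses (hC : compact_spread C) (CW : C W) (CX : C X).
Let k := invmx (gl_mx g).
Hypotheses
  (gW : forall v, (v \in \val W) = ((k *m v) 2%:R 0 == 0) && ((k *m v) 3%:R 0 == 0))
  (gX : forall v, (v \in \val X) = ((k *m v) 0 0 == 0) && ((k *m v) 1 0 == 0)).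
(* A line [l <> W] of the spread meets the plane [y_3 = 0] through [W] in the
   point with coordinates [N l 0 3 : N l 1 3 : N l 2 3 : 0]. *)
Let N := chart g.

Let N23_eq0 l : C (forget l) -> N l 2%:R 3%:R = 0 -> forget l = W.
Proof.
move=> Cl /chart_meet[v [v0 vl v2 v3]]; apply: (spread_uniq hC Cl CW v0 vl).
by rewrite gW /k v2 v3 eqxx.
Qed.

Let N01_eq0 l : C (forget l) -> N l 0 1 = 0 -> forget l = X.
Proof.
move=> Cl /chart_meet[v [v0 vl v2 v3]]; apply: (spread_uniq hC Cl CX v0 vl).
by rewrite gX /k v2 v3 eqxx.
Qed.

Let NW l i : forget l = W -> N l 2%:R i = 0 /\ N l 3%:R i = 0.
Proof.
by move=> lW; split; apply: chart_vanish => v; rewrite lW gW => /andP[/eqP ? /eqP ?].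
Qed.

Let NX l i : forget l = X -> N l 0 i = 0 /\ N l 1 i = 0.
Proof.
by move=> lX; split; apply: chart_vanish => v; rewrite lX gX => /andP[/eqP ? /eqP ?].
Qed.

Let WX : W <> X.
Proof.
move=> WX; have [v /eqP v0 vW] := line_neq0 W; have vX := vW; rewrite WX in vX.
move: vW vX; rewrite gW gX => /andP[/eqP v2 /eqP v3] /andP[/eqP v00 /eqP v1].
apply: v0; rewrite -[v](mulKVmx (gl_unit g)) -/k.
suff -> : k *m v = 0 by rewrite mulmx0.
by apply: cV4P; rewrite [RHS]mxE.
Qed.

(** An arbitrary orientation of [L]. Reversing it negates [N], which leaves [stereo] and hence [f]
    unchanged. *)
Let lift L : oline R := sval (cid (forget_surj L)).
Let liftP L : forget (lift L) = L. Proof. exact: svalP (cid (forget_surj L)). Qed.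

Let fl l := stereo (N l 0 3%:R) (N l 1 3%:R) (N l 2%:R 3%:R).
Let f L := fl (lift L).

Let f_forget l : f (forget l) = fl l.
Proof.
rewrite /f /fl /N; have [->|->] := forget_chart g (esym (liftP (forget l))) => //.
by rewrite !oppmxE stereo_opp.
Qed.

Let N_plucker l : N l 0 1 * N l 2%:R 3%:R =
  N l 0 2%:R * N l 1 3%:R - N l 1 2%:R * N l 0 3%:R.
Proof. by rewrite /N; have [u [v ->]] := chart_wedge g l; rewrite !wedgeE; ring. Qed.

Let fl_cvg l : C (forget l) -> fl m @[m --> l] --> fl l.
Proof.
move=> Cl.
suff H (F : set_system (oline R)) (FF : Filter F) :
    (forall i j, N m i j @[m --> F] --> N l i j) -> fl m @[m --> F] --> fl l.
  by apply: (H (nbhs l)) => i j; exact: chart_cvg.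
move=> Nc; have [l0|l0] := eqVneq (N l 2%:R 3%:R) 0; last first.
  by apply: stereo_cvg => //; rewrite sum_sq_eq0 (negbTE l0) !andbF.
have lW := N23_eq0 Cl l0.
(* At [W] the required relation is [N_plucker]. Its leading factor [N m 0 1] has a nonzero limit,
   because only [X] annihilates it. *)
apply: (@stereo_cvg_pole _ _ _ _ _ _ _ _ _ _
  (fun m => N m 0 1) (fun m => N m 0 2%:R) (fun m => N m 1 2%:R) (N l 0 1)) => //.
- by apply/eqP => /(N01_eq0 Cl) lX; apply: WX; rewrite -lW.
- have -> : (0 : R) = N l 0 2%:R by rewrite /N chart_skew (NW 0 lW).1 oppr0.
  exact: Nc.
- have -> : (0 : R) = N l 1 2%:R by rewrite /N chart_skew (NW 1 lW).1 oppr0.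
  exact: Nc.
Qed.

Let f_continuous : {within C, continuous f}.
Proof.
suff H L A : C L -> nbhs (f L) A -> nbhs L (f @^-1` A).
  by apply/subspace_continuousP => L CL; apply: cvg_within_filter => A; exact: H.
rewrite -(liftP L) => CL; rewrite f_forget => /(fl_cvg CL) fA; apply/forget_nbhs.
by have -> : @forget R @^-1` (f @^-1` A) = fl @^-1` A
  by apply/funext => m; rewrite /= f_forget.
Qed.

(** The image determines the point in which a line other than [W] meets the plane [y_3 = 0], here
    scaled to third coordinate [1]; two spread lines through one point coincide. *)
Let f_inj : set_inj C f.
Proof.
move=> L L'; rewrite !inE -(liftP L) -(liftP L'); move: (lift L) (lift L') => l m Cl Cm.
rewrite !f_forget => e.
have [l0|l0] := eqVneq (N l 2%:R 3%:R) 0; last first.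
  have [m0 e0 e1] := stereo_inj l0 e.
  apply: (spread_uniq hC Cl Cm (v := (N l 2%:R 3%:R)^-1 *: (gl_mx g *m col 3%:R (N l)))).
  - rewrite scaler_eq0 invr_eq0 (negbTE l0) /=; apply/eqP => /(congr1 (mulmx k)).
    rewrite mulKmx ?gl_unit // mulmx0 => /(congr1 (fun v : V => v 2%:R 0)).
    by rewrite /= colmxE [RHS]mxE => /eqP; rewrite (negbTE l0).
  - by rewrite memvZ // chart_mem.
  suff -> : (N l 2%:R 3%:R)^-1 *: (gl_mx g *m col 3%:R (N l)) =
      (N m 2%:R 3%:R)^-1 *: (gl_mx g *m col 3%:R (N m)) by rewrite memvZ // chart_mem.
  rewrite !scalemxAr; congr (_ *m _).
  apply: cV4P; rewrite [LHS]mxE [RHS]mxE !colmxE.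
  - by rewrite mulrC e0 mulrC.
  - by rewrite mulrC e1 mulrC.
  - by rewrite !mulVf.
  - by rewrite /N !chart_diag !mulr0.
have m0 : N m 2%:R 3%:R = 0.
  by apply: contrapT => /eqP m0; have [] := stereo_inj m0 (esym e); rewrite l0 eqxx.
by rewrite (N23_eq0 Cl l0) (N23_eq0 Cm m0).
Qed.

Let f_surj : set_surj C (@unit_sphere2 R) f.
Proof.
move=> s s1; have [s2|s2] := eqVneq (s 0 2%:R) 1.
  exists W => //; rewrite -(liftP W) f_forget /fl.
  have [-> _] := NW 3%:R (liftP W); rewrite stereo_pole.
  move: s1; rewrite /unit_sphere2 /= rV3_sum s2 expr1n => /eqP.
  rewrite -[X in _ == X]add0r (inj_eq (addIr _)) paddr_eq0 ?sqr_ge0 // !sqrf_eq0.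
  move=> /andP[/eqP s0 /eqP s1]; apply: rV3P; rewrite ?s0 ?s1 ?s2 mxE /=; ring.
(* By [stereoK] this point of the plane [y_3 = 0] projects to [s], so the spread line through it is
   a preimage. *)
pose y : V := \col_i [:: s 0 0; s 0 1; 1 - s 0 2%:R; 0]`_i.
have y2 : y 2%:R 0 != 0 by rewrite mxE /= subr_eq0 eq_sym.
have p0 : gl_mx g *m y != 0.
  apply: contra_neq y2 => /(congr1 (mulmx k)); rewrite mulKmx ?gl_unit // mulmx0 => ->.
  by rewrite mxE.
have [L CL pL] := spread_cover hC p0.
exists L => //; rewrite -(liftP L) in CL pL *; rewrite f_forget.
move: (lift L) CL pL => l Cl pl_.
have l0 : N l 2%:R 3%:R != 0.
  apply: contraNneq y2 => /(N23_eq0 Cl) lW; move: pl_; rewrite lW gW.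
  by rewrite /k mulKmx ?gl_unit // => /andP[].
rewrite -[RHS](stereoK s1 s2) /fl.
have [t t0 col] : exists2 t, t != 0 & forall i, N l i 3%:R = t * y i 0.
  exists (N l 2%:R 3%:R / (1 - s 0 2%:R)) => [|i].
    by rewrite mulf_neq0 // invr_eq0 subr_eq0 eq_sym.
  have := @chart_collinear _ g l _ i 2%:R 3%:R pl_.
  rewrite mulKmx ?gl_unit // [y 3%:R 0]mxE => /(_ erefl) e.
  by rewrite mulrAC -e [y 2%:R 0]mxE /= mulfK // subr_eq0 eq_sym.
rewrite (col 0) (col 1) (col 2%:R) ![y _ _]mxE /=.
exact: stereo_scale.
Qed.

Let f_bij : set_bij C (@unit_sphere2 R) f.
Proof. split; [|exact: f_inj|exact: f_surj].
by move=> L _; exact: stereo_sphere. Qed.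

Let f_homeo : homeomorphism_on C (@unit_sphere2 R) f.
Proof.
apply: (@compact_homeomorphism _ _ _ _ _ (base_line R)) => //.
by case: hC.
Qed.

Lemma chart_two_sphere : two_sphere R C.
Proof. by exists f. Qed.

(** The product of the two coordinates is even in [N], hence a function of unoriented lines. *)
Let psi L := N (lift L) 0 1 * N (lift L) 2%:R 3%:R.

Let psi_forget l : psi (forget l) = N l 0 1 * N l 2%:R 3%:R.
Proof.
rewrite /psi /N; have [->|->] := forget_chart g (esym (liftP (forget l))) => //.
by rewrite !oppmxE mulrNN.
Qed.

Let psi_continuous : continuous psi.
Proof.
suff H L A : nbhs (psi L) A -> nbhs L (psi @^-1` A) by move=> L A; exact: H.
rewrite -(liftP L) psi_forget => H; apply/forget_nbhs.
have -> : @forget R @^-1` (psi @^-1` A) = (fun l => N l 0 1 * N l 2%:R 3%:R) @^-1` A.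
  by apply/funext => m; rewrite /= psi_forget.
have c : N l 0 1 * N l 2%:R 3%:R @[l --> lift L] --> N (lift L) 0 1 * N (lift L) 2%:R 3%:R.
  exact: (cvgM (@chart_cvg _ g (lift L) 0 1) (@chart_cvg _ g (lift L) 2%:R 3%:R)).
exact: c H.
Qed.

(** If the first two projective coordinates of the point vanish, the Pluecker relation gives
    [N l 0 1 * N l 2%:R 3%:R = 0], which forces [X] or [W]. *)
Let off_axis_line L : C L -> off_axis (f L) <-> L <> W /\ L <> X.
Proof.
rewrite -(liftP L); move: (lift L) => l Cl; rewrite f_forget; split.
  move=> /stereo_off_axis[c0 ab0].
  split=> [lW|lX]; first by rewrite (NW 3%:R lW).1 eqxx in c0.
  by move: ab0; rewrite (NX 3%:R lX).1 (NX 3%:R lX).2 eqxx.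
move=> [lW lX]; have c0 : N l 2%:R 3%:R != 0 by apply/eqP => /(N23_eq0 Cl).
have e0 : N l 0 1 != 0 by apply/eqP => /(N01_eq0 Cl).
apply/stereo_off_axis; split=> //; apply: contraNT (mulf_neq0 e0 c0).
by rewrite N_plucker negb_or !negbK => /andP[/eqP -> /eqP ->]; apply/eqP; ring.
Qed.

Lemma chart_sign : exists2 e : R, e != 0 &
  forall l, C (forget l) -> chart g l 0 1 + e * chart g l 2%:R 3%:R != 0.
Proof.
have [_ _ [h hK hc]] := f_homeo.
pose S := @unit_sphere2 R `&` off_axis (R := R).
have psi0 L : C L -> L <> W -> L <> X -> psi L != 0.
  rewrite -(liftP L); move: (lift L) => l Cl lW lX; rewrite psi_forget.
  by apply: mulf_neq0; apply/eqP; [move/(N01_eq0 Cl)|move/(N23_eq0 Cl)].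
have /connected_intervalP iE : connected ((psi \o h) @` S).
  apply: connected_continuous_connected; first exact: sphere_off_axis_connected.
  have : {within S, continuous h} by apply: continuous_subspaceW hc => s [].
  move=> /subspace_continuousP hS; apply/subspace_continuousP => s Ss.
  exact: (cvg_comp _ _ (hS s Ss) (@psi_continuous (h s))).
have E0 : ~ ((psi \o h) @` S) 0.
  move=> [s [s1 sax]] /=; have [L CL fL] := f_surj s1.
  rewrite -fL in sax *; rewrite hK ?inE //.
  by have [lW lX] := (off_axis_line CL).1 sax; apply/eqP; exact: psi0.
have EL L : C L -> L <> W -> L <> X -> ((psi \o h) @` S) (psi L).
  move=> CL lW lX; exists (f L); last by rewrite /= hK ?inE.
  by split; [exact: stereo_sphere|apply/off_axis_line].
(* [e] is the constant sign of [psi] away from [W] and [X]: the values form an interval that misses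
   [0]. *)
have [e [e0 eE]] : exists e : R, e != 0 /\ forall x : R, ((psi \o h) @` S) x -> 0 < e * x.
  have [[x Ex x0]|nx] := pselect (exists2 x : R, ((psi \o h) @` S) x & 0 < x).
    exists 1; split=> [|y Ey]; first exact: oner_neq0.
    rewrite mul1r ltNge; apply/negP => y0; apply: E0.
    by apply: (iE _ _ Ey Ex); rewrite y0 ltW.
  exists (-1); split=> [|y Ey]; first by rewrite oppr_eq0 oner_neq0.
  rewrite mulN1r oppr_gt0 ltNge; apply/negP; rewrite le_eqVlt => /orP[/eqP y0|y0].
    by apply: E0; rewrite y0.
  by apply: nx; exists y.
exists e => // l Cl; have [lW|lW] := pselect (forget l = W).
  rewrite (NW 3%:R lW).1 mulr0 addr0; apply/eqP => /(N01_eq0 Cl) lX.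
  by apply: WX; rewrite -lW.
have [lX|lX] := pselect (forget l = X).
  rewrite (NX 1 lX).1 add0r mulf_neq0 //; apply/eqP => /(N23_eq0 Cl) lW'.
  by apply: lW.
have := eE _ (EL _ Cl lW lX); rewrite psi_forget => p0; apply/eqP => s0.
(* A zero of the sum would make [e * psi] equal to minus a square, contradicting its positivity. *)
have : N l 0 1 * (N l 0 1 + e * N l 2%:R 3%:R) = 0 by rewrite s0 mulr0.
have := sqr_ge0 (N l 0 1); rewrite expr2; lra.
Qed.

End SpreadChart.

Section SpreadForm.
Variable R : realType.
Variables (C : set (line R)) (hC : compact_spread C).

Lemma spread_two_sphere : two_sphere R C.
Proof.
have [W [X [CW CX]]] := spread_pair hC; move=> /pair_frame[g [gW gX]].
exact: chart_two_sphere gW gX.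
Qed.

Lemma spread_form : exists w : 'M[R]_4 -> R, [/\ continuous w,
  forall M, w (- M) = - w M & forall l, C (forget l) -> w (pl l) != 0].
Proof.
have [W [X [CW CX]]] := spread_pair hC; move=> /pair_frame[g [gW gX]].
have [e _ eC] := chart_sign hC CW CX gW gX.
set k := invmx (gl_mx g).
exists (fun M => (k *m M *m k^T) 0 1 + e * (k *m M *m k^T) 2%:R 3%:R); split=> //.
  suff H (F : set_system 'M[R]_4) (FF : Filter F) M : x @[x --> F] --> M ->
     (k *m x *m k^T) 0 1 + e * (k *m x *m k^T) 2%:R 3%:R @[x --> F] -->
     (k *m M *m k^T) 0 1 + e * (k *m M *m k^T) 2%:R 3%:R.
    by move=> M; apply: (H (nbhs M)); exact: cvg_id.
  move=> FM; have c : k *m x *m k^T @[x --> F] --> k *m M *m k^T.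
    by apply: cvg_mulmx; [apply: cvg_mulmx => //|]; exact: cvg_cst.
  by apply: cvgD; [|apply: cvgM; first exact: cvg_cst]; exact: cvg_coord.
by move=> M; rewrite mulmxN mulNmx !oppmxE mulrN opprD.
Qed.

End SpreadForm.

(** * Oriented spreads and the hyperspace *)

Section Metrizes.
Variables (R : realType) (T : topologicalType) (d : T -> T -> R).
Hypothesis md : metrizes d.

Lemma metrizes_xx x : d x x = 0.
Proof. by case: md => d0 _ _ _; apply/d0. Qed.

Lemma metrizes_ball x (e : R) : 0 < e -> nbhs x [set y | d x y < e].
Proof. by case: md => _ _ _ dn e0; apply/dn; exists e. Qed.

Lemma metrizes_hausdorff : hausdorff_space T.
Proof.
case: md => d0 dC dT _ x y xy; apply/d0/eqP; rewrite eq_le; apply/andP; split; last first.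
  by have := dT x y x; rewrite metrizes_xx [d y x]dC; lra.
rewrite leNgt; apply/negP => xy0; have h : 0 < d x y / 2 by rewrite divr_gt0.
have [z [/= xz yz]] := xy _ _ (metrizes_ball x h) (metrizes_ball y h).
by have := dT x z y; rewrite [d z y]dC; lra.
Qed.

(** A Lebesgue number argument: if [Q] holds on the [e]-ball around [x], radius [e / 2] serves all
    points within [e / 2] of [x], and compactness of [K] yields a common radius. *)
Lemma metrizes_uniform (K : set T) (Q : T -> T -> Prop) : compact K ->
  (forall x, K x -> exists2 A, nbhs x A & forall y z, A y -> A z -> Q y z) ->
  exists2 r : R, 0 < r & forall x y, K x -> d x y < r -> Q x y.
Proof.
case: (md) => d0 dC dT dn /compact_near_coveringP cK KQ.
have : \forall r \near (0:R)^'+, K `<=` [set x | forall y, d x y < r -> Q x y].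
  apply: cK => x Kx; have [A /dn[e e0 eA] AQ] := KQ x Kx.
  have h : 0 < e / 2 by rewrite divr_gt0.
  exists ([set y | d x y < e / 2], [set r | r < e / 2]) => /=.
    by split; [exact: metrizes_ball|exact: nbhs_right_lt].
  move=> [y r] /= [xy re] z yz; apply: AQ; apply: eA => /=; first by lra.
  by have := dT x y z; lra.
move=> near_r; have [r [rK r0]] := filter_ex (filterI near_r (nbhs_right_gt 0)).
by exists r => // x y /rK; exact.
Qed.

Lemma hausdorff_ball_nbhs (K : hyperspace d) (e : R) : 0 < e ->
  nbhs K [set K' : hyperspace d | hausdorff_ball d (hset K) e (hset K')].
Proof.
case: (md) => _ _ dT _ e0; rewrite nbhsE.
(* A radius [r < e] common to all points leaves room for the triangle inequality, so this smaller
   set is open. *)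
exists [set K' : hyperspace d | exists2 r, r < e & hausdorff_ball d (hset K) r (hset K')].
  split; last first.
    exists (e / 2); first by lra.
    by split=> x Kx; exists x => //; rewrite metrizes_xx divr_gt0.
  move=> K' [r re [KK' K'K]]; exists ((e - r) / 2); first by lra.
  move=> K'' [K'K'' K''K']; exists ((e + r) / 2); first by lra.
  split=> x Kx.
    have [y K'y xy] := KK' _ Kx; have [z K''z yz] := K'K'' _ K'y.
    by exists z => //; have := dT x y z; lra.
  have [y K'y yx] := K''K' _ Kx; have [z Kz zy] := K'K _ K'y.
  by exists z => //; have := dT z y x; lra.
by move=> K' [r re]; exact/hausdorff_ballS/ltW.
Qed.

End Metrizes.

(** * The two sheets over a spread *)

Section Covers.
Variable R : realType.
Implicit Types (l m : oline R) (L : line R) (C : set (line R)) (S : set (oline R)).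
Implicit Types (w : 'M[R]_4 -> R).

Definition odd_form w := continuous w /\ forall M, w (- M) = - w M.

Definition nonvanishing w C := forall l, C (forget l) -> w (pl l) != 0.

Definition sheet w C : set (oline R) := [set l | C (forget l) /\ 0 < w (pl l)].

(** For odd [w] the default is taken only over lines on which [w] vanishes. *)
Definition section w L : oline R :=
  xget (base_oline R) [set l | forget l = L /\ 0 < w (pl l)].

Lemma odd_form_opp w : odd_form w -> odd_form (fun M => - w M).
Proof.
move=> [wc wN]; split=> [M|M]; last by rewrite wN.
exact: cvgN (wc M).
Qed.

Lemma nonvanishing_opp w C : nonvanishing w C -> nonvanishing (fun M => - w M) C.
Proof. by move=> wC l Cl; rewrite oppr_eq0 wC. Qed.

Lemma section_unique w l m : odd_form w -> forget l = forget m ->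
  0 < w (pl l) -> 0 < w (pl m) -> l = m.
Proof.
move=> [_ wN] lm l0 m0; apply: pl_inj; have [//|e] := forget_pl lm.
by move: m0; rewrite e wN oppr_gt0 ltNge (ltW l0).
Qed.

Lemma sectionK w l : odd_form w -> 0 < w (pl l) -> section w (forget l) = l.
Proof.
move=> ow l0; rewrite /section; case: xgetP => [m _ [ml m0]|/(_ l) []//].
exact: section_unique ow ml m0 l0.
Qed.

Lemma sheet_lift w C L : odd_form w -> nonvanishing w C -> C L ->
  exists2 l, sheet w C l & forget l = L.
Proof.
move=> [_ wN] wC; have [l <-] := forget_surj L => Cl.
have := wC l Cl; rewrite neq_lt => /orP[l0|l0]; last by exists l.
have [m ml mE] := opposite_ex l; exists m => //; split; first by rewrite ml.
by rewrite mE wN oppr_gt0.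
Qed.

(** This is continuity of [section w] at [forget l], deduced from openness of [forget]. *)
Lemma section_nbhs w l (A : set (oline R)) : odd_form w -> 0 < w (pl l) ->
  nbhs l A -> nbhs (forget l) [set L | exists m, [/\ A m, forget m = L & 0 < w (pl m)]].
Proof.
move=> [wc _] l0 lA.
have wl : w (pl m) @[m --> l] --> w (pl l).
  exact: (cvg_comp _ _ (@pl_continuous R l) (wc (pl l))).
have l0' : nbhs l [set m | 0 < w (pl m)] by exact: (cvgr_gt _ wl).
apply: filterS (forget_open (filterI lA l0')) => _ [m [Am m0] <-].
by exists m.
Qed.

Lemma sheetE w C : odd_form w -> nonvanishing w C -> sheet w C = section w @` C.
Proof.
move=> ow wC; apply/seteqP; split=> [l [Cl l0]|_ [L CL <-]].
  by exists (forget l) => //; exact: sectionK.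
by have [l [Cl l0] <-] := sheet_lift ow wC CL; rewrite sectionK.
Qed.

Lemma sheet_compact w C : odd_form w -> nonvanishing w C -> compact C -> compact (sheet w C).
Proof.
move=> ow wC cC; rewrite sheetE //; apply: continuous_compact cC.
apply/subspace_continuousP => L CL; apply: cvg_within_filter.
suff H A : nbhs (section w L) A -> nbhs L (section w @^-1` A) by move=> A; exact: H.
have [l [Cl l0] <-] := sheet_lift ow wC CL; rewrite sectionK //.
move=> /(section_nbhs ow l0); apply: filterS => _ [m [Am <- m0]] /=.
by rewrite sectionK.
Qed.

Lemma forget_image C S : oriented_spread_covering C S -> @forget R @` S = C.
Proof.
move=> [S' [_ _ _ [[fS _ sS] _ _] _]]; apply/seteqP; split=> [_ [l Sl <-]|L CL].
  exact: fS.
by have [l Sl <-] := sS _ CL; exists l.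
Qed.

Lemma two_sphere_connected (X : topologicalType) (A : set X) :
  two_sphere R A -> connected A.
Proof.
move=> [f [[fA _ sf] _ [h hK hc]]].
have -> : A = h @` (@unit_sphere2 R).
  apply/seteqP; split=> [x Ax|_ [s /sf[x Ax <-] <-]].
    by exists (f x); [exact: fA|rewrite hK ?inE].
  by rewrite hK ?inE.
exact: connected_continuous_connected (@sphere_connected R) hc.
Qed.

(** [S] is a sphere, hence connected, so [w] has constant sign on it. As [S] maps onto [C], it
    contains every orientation of that sign. *)
Lemma covering_sheet w C S : odd_form w -> nonvanishing w C ->
  oriented_spread_covering C S -> S = sheet w C \/ S = sheet (fun M => - w M) C.
Proof.
move=> ow wC cS; have imS := forget_image cS.
have SC l : S l -> C (forget l) by move=> Sl; rewrite -imS; exists l.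
have H w' : odd_form w' -> (forall l, S l -> 0 < w' (pl l)) -> S = sheet w' C.
  move=> ow' S0; apply/seteqP; split=> [l Sl|m [Cm m0]].
    by split; [exact: SC|exact: S0].
  rewrite -imS in Cm; have [l Sl lm] := Cm.
  by rewrite -(section_unique ow' lm (S0 _ Sl) m0).
case: (cS) => S' [_ _ [/two_sphere_connected cnS _] _ _].
have /connected_intervalP iE : connected ((fun l => w (pl l)) @` S).
  apply: connected_continuous_connected cnS _; apply: continuous_subspaceT => l.
  exact: (cvg_comp _ _ (@pl_continuous R l) (ow.1 (pl l))).
have E0 : ~ ((fun l => w (pl l)) @` S) 0.
  by move=> [l Sl l0]; have := wC l (SC _ Sl); rewrite l0 eqxx.
have [[l Sl l0]|nl] := pselect (exists2 l, S l & 0 < w (pl l)); [left|right].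
  apply: H => // m Sm; rewrite ltNge; apply/negP => m0; apply: E0.
  apply: (iE (w (pl m)) (w (pl l))); [by exists m|by exists l|].
  by rewrite m0 ltW.
apply: H => [|m Sm]; first exact: odd_form_opp.
have := wC m (SC _ Sm); rewrite oppr_gt0 neq_lt => /orP[//|m0].
by case: nl; exists m.
Qed.

(** For a topological parallelism this follows from the metric on lines that comes with its
    compactness. *)
Hypothesis line_hausdorff : hausdorff_space (line R).

Lemma sheet_homeomorphism w C : odd_form w -> nonvanishing w C -> compact C ->
  homeomorphism_on (sheet w C) C (@forget R).
Proof.
move=> ow wC cC; apply: (@compact_homeomorphism _ _ _ _ _ (base_oline R)) => //.
- exact: sheet_compact.
- split=> [l []//|l m|L /(sheet_lift ow wC)[l]]; last by exists l.
  by rewrite !inE => -[_ l0] [_ m0] lm; exact: section_unique lm l0 m0.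
- exact/continuous_subspaceT/forget_continuous.
Qed.

Lemma homeomorphism_on_comp (X Y Z : topologicalType) (A : set X) (B : set Y)
    (D : set Z) (f : X -> Y) (f' : Y -> Z) :
  homeomorphism_on A B f -> homeomorphism_on B D f' -> homeomorphism_on A D (f' \o f).
Proof.
have wc (X1 X2 X3 : topologicalType) (A1 : set X1) (A2 : set X2) (p : X1 -> X2) (q : X2 -> X3) :
    set_fun A1 A2 p -> {within A1, continuous p} -> {within A2, continuous q} ->
    {within A1, continuous (q \o p)}.
  move=> pA /subspace_continuousP cp /subspace_continuousP cq.
  apply/subspace_continuousP => x Ax U qU.
  have h : nbhs x (fun y => A1 y -> A2 (p y) -> U (q (p y))) :=
    cp x Ax _ (cq (p x) (pA _ Ax) _ qU).
  have : nbhs x (fun y => A1 y -> U (q (p y))).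
    by apply: filterS h => y /[swap] Ay; apply => //; exact: pA.
  exact.
move=> [bf cf [h hK hc]] [bf' cf' [h' h'K h'c]].
have fA := let: And3 fA _ _ := bf in fA; have sf' := let: And3 _ _ sf' := bf' in sf'.
split; first exact: set_bij_comp bf bf'.
  exact: wc fA cf cf'.
exists (h \o h'); last first.
  apply: (wc _ _ _ _ B) hc => // z /sf'[y By <-].
  by rewrite /= h'K ?inE.
move=> x; rewrite inE => Ax /=; rewrite h'K; last by rewrite inE; exact: fA.
by rewrite hK ?inE.
Qed.

Lemma sheet_covering w C : odd_form w -> nonvanishing w C -> compact_spread C ->
  oriented_spread_covering C (sheet w C).
Proof.
move=> ow wC sC; have [cC _ _] := sC; have [f hf] := spread_two_sphere sC.
have ow' := odd_form_opp ow; have wC' := nonvanishing_opp wC.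
have h := sheet_homeomorphism ow wC cC; have h' := sheet_homeomorphism ow' wC' cC.
exists (sheet (fun M => - w M) C); split=> //.
- apply/seteqP; split=> [l Cl|l [[]|[]]//].
  by have := wC l Cl; rewrite neq_lt => /orP[l0|l0]; [right|left]; split; rewrite ?oppr_gt0.
- apply/seteqP; split=> // l [[_ l0] [_]].
  by rewrite oppr_gt0 ltNge (ltW l0).
- by split; exists (f \o @forget R); [exact: homeomorphism_on_comp h hf|exact: homeomorphism_on_comp h' hf].
Qed.

End Covers.

(** * The oriented parallelism over a parallelism *)

Section ParallelismLift.
Variables (R : realType) (P : set (set (line R))).
Hypothesis hP : topological_parallelism P.

Definition oriented_lift : set (set (oline R)) :=
  [set S | exists2 C, P C & oriented_spread_covering C S].

Let line_hausdorff : hausdorff_space (line R).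
Proof. by case: hP => _ _ _ [_ [d md _]]; exact: metrizes_hausdorff md. Qed.

Let spread_odd_form C : P C -> exists w, odd_form w /\ nonvanishing w C.
Proof.
case: hP => Ps _ _ _ /Ps /spread_form[w [wc wN wC]].
by exists w; split.
Qed.

Let compactP C : P C -> compact C.
Proof. by case: hP => Ps _ _ _ /Ps[]. Qed.

(** A common oriented line forces the underlying spreads to be equal; the two sheets over one spread
    are disjoint because [w] has opposite signs on them. *)
Lemma oriented_lift_trivIset : trivIset oriented_lift id.
Proof.
move=> S1 S2 [C1 PC1 c1] [C2 PC2 c2] [l [l1 l2]].
have C12 : C1 = C2.
  case: hP => _ tP _ _; apply: tP => //; exists (forget l).
  by rewrite -(forget_image c1) -(forget_image c2); split; exists l.
rewrite -C12 in c2; have [w [ow wC]] := spread_odd_form PC1.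
move: l1 l2; have [->|->] := covering_sheet ow wC c1;
  have [->|->] := covering_sheet ow wC c2 => // -[_ l0] [_].
  by rewrite oppr_gt0 ltNge (ltW l0).
by move: l0; rewrite oppr_gt0 ltNge => /negbTE + /ltW => ->.
Qed.

Lemma oriented_lift_cover : \bigcup_(S in oriented_lift) S = setT.
Proof.
apply/seteqP; split=> // l _.
have : [set: line R] (forget l) by [].
case: (hP) => Ps _ <- _ [C PC Cl]; have [w [ow wC]] := spread_odd_form PC.
have := wC l Cl; rewrite neq_lt => /orP[l0|l0].
  exists (sheet (fun M => - w M) C); last by split; rewrite ?oppr_gt0.
  exists C => //; apply: sheet_covering (Ps _ PC) => //.
    exact: odd_form_opp.
  exact: nonvanishing_opp.
exists (sheet w C) => //; exists C => //; exact: sheet_covering (Ps _ PC).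
Qed.

Let lift_compact : oriented_lift `<=` compact.
Proof.
move=> S [C PC cS]; have [w [ow wC]] := spread_odd_form PC.
have [->|->] := covering_sheet ow wC cS; apply: sheet_compact (compactP PC) => //.
  exact: odd_form_opp.
exact: nonvanishing_opp.
Qed.

Let image_compact (K : hyperspace (@pl_dist R)) :
  compact (@forget R @` hset K).
Proof.
apply: continuous_compact; last exact: hset_compact.
exact/continuous_subspaceT/forget_continuous.
Qed.

Lemma oriented_lift_compact : hyperspace_compact R oriented_lift.
Proof.
split=> //; exists (@pl_dist R); first exact: pl_dist_metrizes.
have [_ _ _ [_ [d md cP]]] := hP.
rewrite compact_ultra => F FU FL.
(* [down] takes the ultrafilter to the parallelism below, whose metric [d] need not be related to
   [pl_dist]. *)
pose down (K : hyperspace (@pl_dist R)) := Hyperspace d (@image_compact K).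
have downP : \forall K \near F, P (hset (down K)).
  by apply: filterS FL => K [C PC cK] /=; rewrite (forget_image cK).
have [C0 [PC0 C0cl]] := cP (down @ F) _ downP.
(* For an ultrafilter a cluster point is a limit: otherwise the complement of a ball around [C0]
   would belong to its image. *)
have near_C0 (e : R) : 0 < e -> \forall K \near F, hausdorff_ball d (hset C0) e (hset (down K)).
  move=> e0; have nC0 := hausdorff_ball_nbhs md C0 e0.
  have [//|nF] := in_ultra_setVsetC [set K | hausdorff_ball d (hset C0) e (hset (down K))] FU.
  have [K' []] := C0cl (~` [set K' | hausdorff_ball d (hset C0) e (hset K')]) _ nF nC0.
  by [].
have [w [ow wC0]] := spread_odd_form PC0.
(* One [w], chosen for [C0], stays nonzero on all lines within [r] of [C0], so it also splits the
   spreads near [C0]. *)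
have [r r0 wr] : exists2 r : R, 0 < r &
    forall L L', hset C0 L -> d L L' < r -> forall l, forget l = L' -> w (pl l) != 0.
  apply: (metrizes_uniform md (Q := fun _ L' => forall l, forget l = L' -> w (pl l) != 0)).
    exact: hset_compact.
  move=> L CL; have [l lL] := forget_surj L.
  exists [set L' | forall l, forget l = L' -> w (pl l) != 0] => //.
  rewrite -lL; apply/forget_nbhs.
  have wl : w (pl m) @[m --> l] --> w (pl l).
    exact: (cvg_comp _ _ (@pl_continuous R l) (ow.1 (pl l))).
  have l0 : w (pl l) != 0 by apply: wC0; rewrite lL.
  apply: filterS (cvgr_neq0 _ wl l0) => m m0 m' /esym/forget_pl[] -> //.
  by rewrite ow.2 oppr_eq0.
have near_sheet : \forall K \near F,
    hset K = sheet w (hset (down K)) \/ hset K = sheet (fun M => - w M) (hset (down K)).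
  apply: filterS (filterI FL (near_C0 r r0)) => K [[C PC cK] [_ CK]].
  have dK : hset (down K) = C := forget_image cK.
  rewrite dK; apply: (covering_sheet ow _ cK) => l Cl.
  have /CK[L CL Ll] : hset (down K) (forget l) by rewrite dK.
  exact: wr CL Ll _ erefl.
(* The ultrafilter selects one of the two signs, and the negative one is the positive one for the
   opposite form. *)
suff main w' : odd_form w' -> nonvanishing w' (hset C0) ->
    (\forall K \near F, hset K = sheet w' (hset (down K))) ->
    exists K0, oriented_lift (hset K0) /\ F --> K0.
  have [Fw|Fw] := in_ultra_setVsetC [set K | hset K = sheet w (hset (down K))] FU.
    by have [K0 []] := main w ow wC0 Fw; exists K0.
  have [|K0 []] := main _ (odd_form_opp ow) (nonvanishing_opp wC0); last by exists K0.
  by apply: filterS (filterI near_sheet Fw) => K [[]].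
move: w' => {w ow wC0 r r0 wr near_sheet} w ow wC0 Fw.
have c0 : compact (sheet w (hset C0)) by exact: (sheet_compact ow wC0 (compactP PC0)).
have [Ps _ _ _] := hP.
exists (Hyperspace (@pl_dist R) c0); split.
  by exists (hset C0) => //; exact: sheet_covering (Ps _ PC0).
move=> A; rewrite nbhsE => -[B [oB BK0] BA].
have [e e0 eB] := oB _ BK0.
(* Uniform continuity of the section near [C0] carries Hausdorff closeness of spreads over to their
   sheets. *)
have [s s0 ws] : exists2 s : R, 0 < s & forall L L', hset C0 L -> d L L' < s ->
    pl_dist (section w L) (section w L') < e.
  apply: (metrizes_uniform md (Q := fun L L' => pl_dist (section w L) (section w L') < e)).
    exact: hset_compact.
  move=> L /(sheet_lift ow wC0)[l [Cl l0] <-].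
  have h : 0 < e / 2 by lra.
  apply: ex_intro2 (section_nbhs ow l0 (metrizes_ball (@pl_dist_metrizes R) l h)) _.
  move=> _ _ [m [lm <- m0]] [n [ln <- n0]]; rewrite !sectionK //.
  have [_ dC dT _] := @pl_dist_metrizes R.
  by have := dT m l n; rewrite [pl_dist m l]dC; move: lm ln => /=; lra.
apply: filterS (filterI Fw (near_C0 s s0)) => K [Kw [C0K KC0]]; apply/BA/eB => /=.
have Ksec m : hset K m -> section w (forget m) = m.
  by rewrite Kw => -[_ m0]; exact: sectionK.
split=> [l [Cl l0]|m Km].
  have [_ [m Km <-] lm] := C0K _ Cl; exists m => //.
  by rewrite -(sectionK ow l0) -(Ksec m Km); exact: ws.
have [L CL Lm] := KC0 (forget m) (ex_intro2 _ _ m Km erefl).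
exists (section w L); last by rewrite -(Ksec m Km); exact: ws.
by rewrite sheetE //; exists L.
Qed.

End ParallelismLift.

Theorem proposition2p2 (R : realType) (Pi : set (set (line R)))
  (hPi : topological_parallelism Pi) :
  exists! Pi_plus : set (set (oline R)),
    oriented_topological_parallelism Pi_plus /\
    Pi_plus = [set S | exists2 C, Pi C & oriented_spread_covering C S].
Proof.
exists (oriented_lift Pi); split=> [|Q [_ ->]//]; split=> //; split.
- by case: hPi => Ps _ _ _ S [C /Ps sC cS]; exists C.
- exact: oriented_lift_trivIset.
- exact: oriented_lift_cover.
- exact: oriented_lift_compact.
Qed.
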